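(* Let $G$ be a finite $2$-group of conjugate type $\{1,8\}$ and nilpotency class $2$. Let $\mathcal{G}$ be a fixed group in the family $\hat{\mathcal{G}}_3$, minimally generated by $\{a,b,c,d\}$. Then $G$ is isoclinic to one of the following groups: (i) a finite Camina $2$-group with commutator subgroup of order $8$; (ii) the group $\mathcal{G}$; (iii) the quotient group $\mathcal{G}/M$, where $M$ is the normal subgroup $M=\langle [a,b][c,d]\rangle$ of $\mathcal{G}$; (iv) the quotient group $\mathcal{G}/N$, where $N$ is the normal subgroup $N=\langle [a,b][c,d],\ [a,c][b,d][c,d]\rangle$ of $\mathcal{G}$.
   Context: A finite group is of conjugate type $\{m_1,\dots,m_n\}$ if the set of its conjugacy class sizes is exactly $\{m_1,\dots,m_n\}$. The commutator is $[x,y]=x^{-1}y^{-1}xy$; $G'$ is the commutator subgroup. Two finite groups $G,H$ are isoclinic if there are isomorphisms $\phi: G/Z(G)\to H/Z(H)$ and $\theta: G'\to H'$ such that $\theta([x,y])=[x',y']$ whenever $x,y\in G$, $x'\in\phi(xZ(G))$ and $y'\in\phi(yZ(G))$. A finite group $G$ is a Camina group if $x^G=xG'$ for all $x\in G\setminus G'$, where $x^G$ is the conjugacy class of $x$. A non-abelian finite $p$-group $K$ is special if $Z(K)=K'=\Phi(K)$ is elementary abelian. The family $\hat{\mathcal{G}}_3$ consists of all non-abelian special $2$-groups of order $2^{10}$ whose minimal number of generators is $4$. *)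

(* Defs.v *)
From mathcomp Require Import all_boot all_fingroup all_solvable.

Set Implicit Arguments.
Unset Strict Implicit.
Unset Printing Implicit Defensive.

Import GroupScope.

Definition conjugate_type (gT : finGroupType) (G : {group gT}) (s : seq nat) :=
  forall m : nat, (exists2 x, x \in G & #|x ^: G| = m) <-> m \in s.

(* The values of phi are elements of H / 'Z(H), i.e. cosets of 'Z(H); they
   coerce to {set hT}, so x' and y' range over all representatives. *)
Definition isoclinic (gT hT : finGroupType) (G : {group gT}) (H : {group hT}) :=
  exists (phi : {morphism G / 'Z(G) >-> coset_of 'Z(H)})
         (theta : {morphism G^`(1) >-> hT}),
    [/\ isom (G / 'Z(G)) (H / 'Z(H)) phi,
        isom G^`(1) H^`(1) theta
      & forall (x y : gT) (x' y' : hT), x \in G -> y \in G ->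
          x' \in (phi (coset 'Z(G) x) : {set hT}) ->
          y' \in (phi (coset 'Z(G) y) : {set hT}) ->
          theta [~ x, y] = [~ x', y'] ].

Definition Camina (gT : finGroupType) (G : {group gT}) :=
  forall x : gT, x \in G :\: G^`(1) -> x ^: G = x *: G^`(1).

(* MathComp's [special] says 'Phi(K) = 'Z(K) and K^`(1) = 'Z(K), leaving
   elementary abelianness out; 'm(K) is the least size of a generating set. *)
Definition in_hatG3 (gT : finGroupType) (K : {group gT}) :=
  [/\ 2.-group K, ~~ abelian K, special K & 2.-abelem 'Z(K)]
  /\ #|K| = (2 ^ 10)%N /\ 'm(K) = 4.

Definition min_generates (gT : finGroupType) (A : {set gT}) (K : {group gT}) :=
  minset (fun B : {set gT} => <<B>> == K) A.

(* Main.v *)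
(** For x in G with x^2 not central, C(x) and C(x^2) would have the same index, hence
    coincide; but some g outside C(x) makes [x, g] an involution, so that g centralises
    x^2.  Hence V = G/Z(G) and W = G' are elementary abelian, and the commutator is an
    alternating map V x V -> W all of whose partial maps have rank 3.  Let m = dim V and
    k = dim W.  If k = 3, a central extension of V by W with the same commutator map is
    a Camina group.  If k >= 4, then m = 4: for k >= 6 some element of W is not a
    commutator and can be factored out, and for k = 4, 5 one counts the pairs (u, f) with
    u in the radical of the form obtained by composing the commutator with f in W*, using
    that alternating forms have even rank.  When m = 4, the kernel of the map from the
    exterior square of V onto W has dimension at most 2 and contains no nonzero
    decomposable bivector; a suitable basis of V puts it in the normal form given by the
    relations defining K, K/M or K/N. *)

From HB Require Import structures.
Require Import Defs.
From mathcomp Require Import all_boot all_fingroup all_solvable.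
From mathcomp Require Import all_algebra mxabelem zify.

Set Implicit Arguments.
Unset Strict Implicit.
Unset Printing Implicit Defensive.

Import GroupScope.

(** * Isoclinism from a subdirect product *)

(** No isoclinism is given by formulas on cosets. Each comes from a subgroup [L] of the product of
    the two groups, whose projections cover both factors modulo their centers and are injective on
    L'. When the target is K, K/M or K/N, injectivity is a count: [L] has four generators, L' is
    generated by 6, 5 or 4 commutators, and the derived subgroups of both factors have at least 2^6,
    2^5 or 2^4 elements. What K contributes is |K'| >= 2^6, forced by the order 2^10 and four
    generators. The relations have their origin in the Pfaffian. In dimension 4 and characteristic
    2, a bivector is decomposable exactly when p_ab p_cd + p_ac p_bd + p_ad p_bc vanishes, so the
    kernel has to be anisotropic for this quadratic form, which bounds its dimension by 2. On the
    span of ab + cd and ac + bd + cd the form is s^2 + st + t^2, which has no nontrivial zero over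
    the field with two elements. The bases themselves are found by counting vectors and
    commutators. *)

Lemma commg_mulZ (gT : finGroupType) (G : {group gT}) (x y u v : gT) :
  x \in G -> y \in G -> u \in 'Z(G) -> v \in 'Z(G) -> [~ x * u, y * v] = [~ x, y].
Proof.
move=> Gx Gy /centerP[Gu cGu] /centerP[Gv cGv].
have cuy : [~ u, y * v] = 1 by apply/eqP/commgP; apply: cGu; rewrite groupM.
have cvx : [~ x, v] = 1 by apply/eqP/commgP; apply: commute_sym; apply: cGv.
have Gxy : [~ x, y] \in G by rewrite groupR.
have fix_xy z : commute z [~ x, y] -> [~ x, y] ^ z = [~ x, y].
  by move=> czxy; rewrite conjgE -czxy mulKg.
by rewrite commMgJ cuy mulg1 commgMJ cvx mul1g !fix_xy //; [apply: cGu | apply: cGv].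
Qed.

(** Two morphisms on [L] with the same kernel have canonically isomorphic images; this supplies both
    [phi] and [theta] of an isoclinism. *)
Lemma isom_of_eq_ker (aT qT rT : finGroupType) (L : {group aT}) (A : {group qT})
    (B : {group rT}) (q : {morphism L >-> qT}) (f : {morphism L >-> rT}) :
  'ker q = 'ker f -> q @* L = A -> f @* L = B ->
  exists phi : {morphism A >-> rT},
    isom A B phi /\ {in L, forall x, phi (q x) = f x}.
Proof.
move=> kerqf qL fL; have {qL} eqA : (q @* L)%G = A by apply: group_inj.
case: A / eqA; have sker : 'ker q \subset 'ker f by rewrite kerqf.
exists (factm_morphism sker (subxx L)); split; last by move=> x Lx; rewrite /= factmE.
apply/isomP; split; last by rewrite /= morphim_factm.
apply/injmP=> _ _ /morphimP[x Lx _ ->] /morphimP[y Ly _ ->].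
by rewrite /= !factmE // => eqf; apply/rcoset_kerP; rewrite // kerqf; apply/rcoset_kerP.
Qed.

Lemma der1_mulZ (gT : finGroupType) (A B : {group gT}) :
  A \subset B -> B \subset A * 'Z(B) -> A^`(1) = B^`(1).
Proof.
move=> sAB sBAZ; apply/eqP; rewrite eqEsubset dergS //= derg1 gen_subG.
apply/subsetP=> _ /imset2P[x y Bx By ->].
have /mulsgP[a u Aa Zu ->] := subsetP sBAZ x Bx; have /mulsgP[b v Ab Zv ->] := subsetP sBAZ y By.
by rewrite (@commg_mulZ _ B) ?mem_commg // (subsetP sAB).
Qed.

Section ImageModCenter.

Variables (gT lT : finGroupType) (G : {group gT}) (L : {group lT}) (p : {morphism L >-> gT}).
Hypotheses (pG : p @* L \subset G) (GpZ : G \subset p @* L * 'Z(G)).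
Hypothesis injp : 'ker p :&: L^`(1) = 1.

Let memG l : l \in L -> p l \in G.
Proof. by move=> Ll; apply: (subsetP pG); rewrite mem_morphim. Qed.

(** If [p l] is central, every [[~ l, m]] lies in L' and in the kernel of [p], hence is trivial.
    Conversely, the image of [p] covers [G] up to central factors. *)
Lemma center_mod_image l : l \in L -> (p l \in 'Z(G)) = (l \in 'Z(L)).
Proof.
move=> Ll; apply/centerP/centerP => [[_ cpl] | [_ cl]]; split=> //; last 2 first.
- exact: memG.
- move=> _ /(subsetP GpZ)/mulsgP[_ z /morphimP[m Lm _ ->] /centerP[_ cz] ->].
  rewrite /commute mulgA -morphM // (cl m Lm) morphM // -!mulgA; congr (_ * _).
  by apply: commute_sym; apply: cz; exact: memG.
move=> m Lm; apply/commgP; rewrite -in_set1 -[[set _]]injp inE (mem_commg Ll Lm) andbT.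
apply/kerP; rewrite ?groupR // morphR //; apply/eqP/commgP/cpl; exact: memG.
Qed.

Lemma coset_image_morph : {in L &, {morph (fun l => coset 'Z(G) (p l)) : x y / x * y}}.
Proof.
move=> x y Lx Ly; rewrite /= morphM // morphM //;
  by apply: (subsetP (normal_norm (center_normal G))); apply: memG.
Qed.

Definition coset_image := Morphism coset_image_morph.

Lemma ker_coset_image : 'ker coset_image = 'Z(L).
Proof.
apply/setP=> l; have [Ll | nLl] := boolP (l \in L); last first.
  rewrite !inE (negPf nLl); apply/esym/negbTE; apply: contra nLl.
  by move=> Zl; apply: (subsetP (center_sub L)).
rewrite -center_mod_image //; apply/(kerP coset_image Ll)/idP => /= [|/coset_id //].
by apply: coset_idr; apply: (subsetP (normal_norm (center_normal G))); apply: memG.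
Qed.

Lemma im_coset_image : coset_image @* L = G / 'Z(G).
Proof.
apply/setP=> X; apply/morphimP/morphimP => [[l Ll _ ->] | [x Nx Gx ->]].
  exists (p l) => //; last exact: memG.
  by apply: (subsetP (normal_norm (center_normal G))); apply: memG.
have /mulsgP[_ z /morphimP[l _ Ll ->] Zz ->] := subsetP GpZ x Gx.
exists l => //=; rewrite coset_kerr //.
Qed.

Lemma der1_image : p @* L^`(1) = G^`(1).
Proof. by rewrite morphim_der // (der1_mulZ (A := (p @* L)%G) pG GpZ). Qed.

End ImageModCenter.

(* L is the graph of the isoclinism, up to the centers of G and H. *)
Lemma isoclinic_of_graph (gT hT lT : finGroupType) (G : {group gT}) (H : {group hT})
    (L : {group lT}) (p : {morphism L >-> gT}) (q : {morphism L >-> hT}) :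
  p @* L \subset G -> G \subset p @* L * 'Z(G) -> 'ker p :&: L^`(1) = 1 ->
  q @* L \subset H -> H \subset q @* L * 'Z(H) -> 'ker q :&: L^`(1) = 1 ->
  isoclinic G H.
Proof.
move=> pG GpZ injp qH HqZ injq.
have [|phi [isom_phi phiE]] := isom_of_eq_ker (q := coset_image pG) (f := coset_image qH)
  (A := (G / 'Z(G))%G) (B := (H / 'Z(H))%G) _ (im_coset_image pG GpZ) (im_coset_image qH HqZ).
  (* Both maps from [L] have kernel Z(L), which makes [phi] well defined and injective. *)
  by rewrite !ker_coset_image.
have sL'L := der_sub 1 L.
have [|||theta [isom_theta thetaE]] := isom_of_eq_ker (L := L^`(1)%G)
  (q := restrm_morphism sL'L p) (f := restrm_morphism sL'L q)
  (A := G^`(1)%G) (B := H^`(1)%G).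
- by rewrite !ker_restrm ![_ :&: 'ker _]setIC injp injq.
- by rewrite morphim_restrm setIid (der1_image pG GpZ).
- by rewrite morphim_restrm setIid (der1_image qH HqZ).
exists phi, theta; split=> // x y x' y' Gx Gy.
have /mulsgP[_ z /morphimP[l _ Ll ->] Zz ->] := subsetP GpZ x Gx.
have /mulsgP[_ t /morphimP[m _ Lm ->] Zt ->] := subsetP GpZ y Gy.
have inG r : r \in L -> p r \in G by move=> Lr; apply: (subsetP pG); rewrite mem_morphim.
have inH r : r \in L -> q r \in H by move=> Lr; apply: (subsetP qH); rewrite mem_morphim.
have repr_q r s u : r \in L -> u \in 'Z(G) ->
    s \in (phi (coset 'Z(G) (p r * u)) : {set hT}) -> exists2 v, v \in 'Z(H) & s = q r * v.
  move=> Lr Zu; rewrite coset_kerr // (phiE _ Lr) /= val_coset; last first.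
    by apply: (subsetP (normal_norm (center_normal H))); apply: inH.
  rewrite norm_rlcoset; last by apply: (subsetP (normal_norm (center_normal H))); apply: inH.
  by case/lcosetP=> v Zv ->; exists v.
move=> /(repr_q _ _ _ Ll Zz)[v Zv ->] /(repr_q _ _ _ Lm Zt)[w Zw ->].
rewrite (@commg_mulZ _ G) ?inG // (@commg_mulZ _ H) ?inH // -!morphR //.
by rewrite thetaE // mem_commg.
Qed.

(** Modulo the central subgroup generated by the commutators of generators, the generators commute,
    so the quotient is abelian. *)
Lemma der1_gen_central (gT : finGroupType) (S : {set gT}) :
  <<S>>^`(1) \subset 'Z(<<S>>) -> <<S>>^`(1) = <<commg_set S S>>.
Proof.
move=> cL; have sT : <<commg_set S S>> \subset <<S>>^`(1).
  rewrite derg1 gen_subG; apply/subsetP=> _ /imset2P[x y Sx Sy ->].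
  by rewrite mem_commg ?mem_gen.
apply/eqP; rewrite eqEsubset sT andbT.
have nT : <<S>> \subset 'N(<<commg_set S S>>).
  apply: subset_trans (cent_sub _); rewrite centsC.
  exact: subset_trans sT (subset_trans cL (subsetIr _ _)).
apply: der1_min => //; rewrite quotient_gen ?(subset_trans (subset_gen S)) // abelian_gen.
have nS x : x \in S -> x \in 'N(<<commg_set S S>>) by move=> Sx; rewrite (subsetP nT) ?mem_gen.
apply/centsP=> _ /morphimP[x Nx Sx ->] _ /morphimP[y Ny Sy ->].
by apply/commgP; rewrite -morphR //= coset_id // mem_gen // imset2_f.
Qed.

Lemma gen_exponent2 (gT : finGroupType) (T : {set gT}) :
  abelian <<T>> -> {in T, forall x, x ^+ 2 = 1} -> {in <<T>>, forall x, x ^+ 2 = 1}.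
Proof.
move=> abT T2; have gr : group_set [set y in <<T>> | y ^+ 2 == 1].
  apply/group_setP; split=> [|y z]; first by rewrite inE group1 expg1n eqxx.
  rewrite !inE => /andP[Ty /eqP y2] /andP[Tz /eqP z2]; rewrite groupM //=.
  by rewrite expgMn ?y2 ?z2 ?mulg1 //; apply: (centsP abT).
have : <<T>> \subset Group gr.
  by rewrite gen_subG; apply/subsetP=> y Ty; rewrite inE mem_gen //= T2.
by move=> /subsetP sT x /sT; rewrite inE => /andP[_ /eqP].
Qed.

Lemma card_gen_exponent2 (gT : finGroupType) (T : {set gT}) :
  abelian <<T>> -> {in T, forall x, x ^+ 2 = 1} -> (#|<<T>>| <= 2 ^ #|T|)%N.
Proof.
move=> abT T2; have abelT : 2.-abelem <<T>>.
  by apply/abelemP=> //; split=> //; apply: gen_exponent2.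
rewrite (card_pgroup (abelem_pgroup abelT)) leq_exp2l // -rank_abelem //.
by rewrite -grank_abelian // grank_min.
Qed.

Lemma trivial_ker_card (aT rT : finGroupType) (D : {group aT}) (f : {morphism D >-> rT})
    (A : {group aT}) : A \subset D -> (#|A| <= #|f @* A|)%N -> 'ker f :&: A = 1.
Proof.
move=> sAD; rewrite card_morphim (setIidPr sAD) -divgI leqNgt => lt.
apply/eqP; rewrite setIC trivg_card1 eqn_leq cardG_gt0 andbT leqNgt.
by apply: contra lt => gt1; rewrite ltn_Pdiv.
Qed.

(** [L] is generated by the pairs in [S]. L' is elementary abelian and generated by [T], so it has
    at most 2^|T| elements, while its images G' and H' have at least as many; both projections are
    therefore injective on L'. *)
Lemma isoclinic_of_generators (gT hT : finGroupType) (G : {group gT}) (H : {group hT})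
    (S T : {set gT * hT}) :
  {in G^`(1), forall x, x ^+ 2 = 1} -> G^`(1) \subset 'Z(G) ->
  {in H^`(1), forall x, x ^+ 2 = 1} -> H^`(1) \subset 'Z(H) ->
  S \subset setX G H ->
  G \subset <<fst @: S>> * 'Z(G) -> H \subset <<snd @: S>> * 'Z(H) ->
  T \subset <<S>>^`(1) -> commg_set S S \subset <<T>> ->
  (2 ^ #|T| <= #|G^`(1)|)%N -> (2 ^ #|T| <= #|H^`(1)|)%N -> isoclinic G H.
Proof.
move=> G2 cG H2 cH sS GS HS sT genT leG leH; set L := <<S>>%G.
have sL : L \subset setX G H by rewrite gen_subG.
have sLT := subsetT L.
pose p := restrm_morphism sLT (fst_morphism gT hT).
pose q := restrm_morphism sLT (snd_morphism gT hT).
have pL : p @* L = <<fst @: S>>.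
  rewrite morphim_restrm setIid morphim_gen ?subsetT // morphimEsub ?subsetT //.
have qL : q @* L = <<snd @: S>>.
  rewrite morphim_restrm setIid morphim_gen ?subsetT // morphimEsub ?subsetT //.
have pG : p @* L \subset G.
  rewrite pL gen_subG; apply/subsetP=> _ /imsetP[x Sx ->].
  by have := subsetP sS x Sx; rewrite inE => /andP[].
have qH : q @* L \subset H.
  rewrite qL gen_subG; apply/subsetP=> _ /imsetP[x Sx ->].
  by have := subsetP sS x Sx; rewrite inE => /andP[].
have GpZ : G \subset p @* L * 'Z(G) by rewrite pL.
have HqZ : H \subset q @* L * 'Z(H) by rewrite qL.
have sL'L := der_sub 1 L.
have memL' x : x \in L^`(1) -> x.1 \in G^`(1) /\ x.2 \in H^`(1).
  move=> L'x; rewrite -(der1_image pG GpZ) -(der1_image qH HqZ).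
  by split; [apply: (mem_morphim p) | apply: (mem_morphim q)] => //; apply: (subsetP sL'L).
have cL : L^`(1) \subset 'Z(L).
  apply/subsetP=> x L'x.
  have [/(subsetP cG)/centerP[_ c1] /(subsetP cH)/centerP[_ c2]] := memL' x L'x.
  apply/centerP; split; first exact: (subsetP sL'L).
  move=> y Ly; have := subsetP sL y Ly; rewrite inE => /andP[/c1 e1 /c2 e2].
  by rewrite /commute [LHS]surjective_pairing [RHS]surjective_pairing /= e1 e2.
have LT : L^`(1) = <<T>>.
  apply/eqP; rewrite eqEsubset; apply/andP; split; last by rewrite gen_subG.
  by rewrite der1_gen_central // gen_subG.
have cardL' : (#|L^`(1)| <= 2 ^ #|T|)%N.
  rewrite [in leqLHS]LT card_gen_exponent2 // -?LT; last first.
    move=> x Tx; have /memL'[x1 x2] := subsetP sT x Tx.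
    by rewrite [LHS]surjective_pairing; congr (_, _); [apply: G2 | apply: H2].
  exact: abelianS cL (center_abelian L).
apply: (isoclinic_of_graph pG GpZ _ qH HqZ); apply: trivial_ker_card => //.
  by rewrite (der1_image pG GpZ) (leq_trans cardL').
by rewrite (der1_image qH HqZ) (leq_trans cardL').
Qed.

Import GRing.Theory.
Local Open Scope ring_scope.

(** * Alternating maps over the field with two elements *)

Lemma alternating_skew (F : fieldType) m (M : 'M[F]_m) :
  (forall u : 'rV_m, u *m M *m u^T = 0) ->
  forall u v : 'rV_m, v *m M *m u^T = - (u *m M *m v^T).
Proof.
move=> altM u v; have := altM (u + v).
rewrite linearD /= mulmxDr !mulmxDl !altM add0r addr0.
by move=> /eqP; rewrite addr_eq0 => /eqP.
Qed.

(* Split off a hyperbolic plane spanned by the rows u, v of P; E is a basis of its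
   orthogonal complement. *)
Lemma even_rank_alternating (F : fieldType) m (M : 'M[F]_m) :
  (forall u : 'rV_m, u *m M *m u^T = 0) -> ~~ odd (\rank M).
Proof.
have [n] := ubnP m; elim: n m M => // n IHn m M lt_m_n altM.
have skewM := alternating_skew altM.
have [-> | /matrix0Pn[i [j nzMij]]] := eqVneq M 0; first by rewrite mxrank0.
pose u : 'rV[F]_m := delta_mx 0 i.
pose v : 'rV[F]_m := (M i j)^-1 *: delta_mx 0 j.
have uMv : u *m M *m v^T = 1.
  rewrite /u /v -rowE linearZ /= trmx_delta -scalemxAr -colE.
  by apply/rowP=> k; rewrite !ord1 !mxE mulVf.
pose P := col_mx u v; pose J := P *m M *m P^T.
have JE : J = block_mx 0 1 (-1) 0.
  by rewrite /J /P mul_col_mx tr_col_mx mul_col_row !altM uMv skewM uMv.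
pose J' : 'M[F]_(1 + 1) := block_mx 0 (-1) 1 0.
have JJ' : J *m J' = 1%:M.
  rewrite JE mulmx_block !(mul0mx, mulmx0, add0r, addr0) mulNmx mulmxN opprK.
  by rewrite [RHS]scalar_mx_block !mulmx1.
have rankJ : \rank J = 2 by apply/eqP; rewrite -/(row_free J); apply/row_freeP; exists J'.
pose R := kermx (M *m P^T); pose E := row_base R; pose S := col_mx P E.
have EP : E *m M *m P^T = 0.
  by apply/eqP; rewrite -mulmxA -sub_kermx eq_row_base.
have PE : P *m M *m E^T = 0.
  apply/row_matrixP=> a; apply/eqP; rewrite row0; apply/eqP/rowP=> b.
  rewrite -mulmxA row_mul mulmxA; set x := row a P; pose y := row b E.
  have -> : (x *m M *m E^T) 0 b = (x *m M *m y^T) 0 0.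
    by rewrite /y !mxE; apply: eq_bigr => c _; rewrite !mxE.
  rewrite skewM [LHS]mxE [RHS]mxE.
  have -> : (y *m M *m x^T) 0 0 = (E *m M *m P^T) b a.
    rewrite /y /x -!row_mul !mxE; apply: eq_bigr => c _; rewrite !mxE.
    by congr (_ * _); apply: eq_bigr => d _; rewrite !mxE.
  by rewrite EP !mxE oppr0.
have fullS : row_full S.
  rewrite -sub1mx.
  (* The first summand is the projection onto the plane along its orthogonal complement, so the
     second has its rows in [R]. *)
  have -> : 1%:M = M *m P^T *m J' *m P + (1%:M - M *m P^T *m J' *m P) by rewrite addrC subrK.
  rewrite /S -addsmxE addmx_sub_adds ?submxMl //.
  rewrite eq_row_base sub_kermx mulmxBl mul1mx.
  suff -> : M *m P^T *m J' *m P *m (M *m P^T) = M *m P^T by rewrite subrr.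
  by rewrite -(mulmxA _ P) (mulmxA P) -/J -(mulmxA _ J') (mulmx1C JJ') mulmx1.
have rkS : \rank (S *m M *m S^T) = \rank M.
  rewrite mxrankMfree; first by rewrite (eqmxMfull _ fullS).
  by rewrite /row_free mxrank_tr -/(row_full S).
have ES : S *m M *m S^T = block_mx J 0 0 (E *m M *m E^T).
  by rewrite /S mul_col_mx tr_col_mx mul_col_row EP PE.
rewrite -rkS ES rank_diag_block_mx rankJ oddD /=.
apply: IHn => [|w].
  apply: leq_trans (_ : m <= n)%N; last by [].
  rewrite mxrank_ker ltn_subrL; apply/andP; split.
    rewrite lt0n mxrank_eq0; apply/eqP => MP0; move: rankJ.
    by rewrite /J -mulmxA MP0 mulmx0 mxrank0.
  exact: leq_ltn_trans (ltn_ord i).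
by have := altM (w *m E); rewrite trmx_mul !mulmxA.
Qed.

(* The alternating map is (v, u) |-> v *m N u; the last condition says that its values
   span the target space. *)
Record alternating_rank3 m k (N : 'rV['F_2]_m -> 'M['F_2]_(m, k)) : Prop :=
  AlternatingRank3 {
    _ : forall u, u *m N u = 0;
    _ : forall u, u != 0 -> \rank (N u) = 3%N;
    _ : forall f : 'cV_k, (forall u, N u *m f = 0) -> f = 0 }.

Lemma card_F2_rV n : #|{: 'rV['F_2]_n}| = (2 ^ n)%N.
Proof. by rewrite card_mx card_Fp // mul1n. Qed.

Lemma card_F2_rV_kermx m k (A : 'M['F_2]_(m, k)) :
  #|[set u : 'rV_m | u *m A == 0]| = (2 ^ (m - \rank A))%N.
Proof.
have <- : #|rowg (kermx A)| = (2 ^ (m - \rank A))%N by rewrite card_rowg card_Fp // mxrank_ker.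
by apply: eq_card => u; rewrite !inE sub_kermx.
Qed.

Lemma card_F2_cV_kermx m k (A : 'M['F_2]_(m, k)) :
  #|[set f : 'cV_k | A *m f == 0]| = (2 ^ (k - \rank A))%N.
Proof.
rewrite -mxrank_tr -card_F2_rV_kermx -(card_imset _ (@trmx_inj _ _ _)).
apply: eq_card => u; rewrite inE; apply/imsetP/eqP => [[f] | uA0].
  by rewrite inE => /eqP Af0 ->; rewrite -trmx_mul Af0 trmx0.
by exists u^T; rewrite ?trmxK // inE -(trmxK A) -trmx_mul uA0 trmx0.
Qed.

Lemma F2_addvv (V : lmodType 'F_2) (x : V) : x + x = 0.
Proof. by rewrite -mulr2n -scaler_nat (_ : 2%:R = 0) ?scale0r //; apply/val_inj. Qed.

Lemma F2_addr_eq0 (V : lmodType 'F_2) (x y : V) : x + y = 0 -> x = y.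
Proof. by move=> xy0; rewrite -[x]addr0 -(F2_addvv y) addrA xy0 add0r. Qed.

Lemma F2_alternating_sym m k (N : {linear 'rV['F_2]_m -> 'M['F_2]_(m, k)}) :
  (forall u, u *m N u = 0) -> forall u v : 'rV_m, v *m N u = u *m N v.
Proof.
move=> altN u v; have := altN (u + v).
by rewrite linearD mulmxDr !mulmxDl !altN add0r addr0 => /F2_addr_eq0.
Qed.

(* [k] is the dimension of a space of alternating forms, given by [form]; each nonzero
   vector lies in the radical of a subspace of forms of codimension 3. *)
Section AlternatingForms.

Variables (m k : nat) (form : {linear 'cV['F_2]_k -> 'M['F_2]_m}).
Hypothesis form_alt : forall f (u : 'rV_m), u *m form f *m u^T = 0.
Hypothesis form_eq0 : forall f, form f = 0 -> f = 0.
Hypothesis card_null : forall u : 'rV_m, u != 0 ->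
  #|[set f | u *m form f == 0]| = (2 ^ (k - 3))%N.
Hypothesis le4m : (4 <= m)%N.

Let tr_form f : (form f)^T = - form f.
Proof.
apply/matrixP=> i j.
have /rowP/(_ 0) := alternating_skew (form_alt f) (delta_mx 0 i) (delta_mx 0 j).
by rewrite !trmx_delta -!rowE -!colE !mxE.
Qed.

Let rank_form_ge4 f : f != 0 -> \rank (form f) != 2%N -> (4 <= \rank (form f))%N.
Proof.
move=> nzf; have := even_rank_alternating (form_alt f).
have: \rank (form f) != 0 by rewrite mxrank_eq0; apply: contraNneq nzf => /form_eq0->.
by case: (\rank _) => [|[|[|[|]]]].
Qed.

(** Double count of the pairs (u, f) with [u *m form f = 0]: [u = 0] contributes 2^k and every other
    [u] contributes 2^(k - 3). The term 2^m on the left belongs to [f = 0]. *)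
Let count_null :
  (\sum_(f : 'cV['F_2]_k | f != 0%R) 2 ^ (m - \rank (form f)) + 2 ^ m
    = 2 ^ k + (2 ^ m - 1) * 2 ^ (k - 3))%N.
Proof.
have -> : (\sum_(f : 'cV['F_2]_k | f != 0%R) 2 ^ (m - \rank (form f)) + 2 ^ m
            = \sum_(f : 'cV['F_2]_k) 2 ^ (m - \rank (form f)))%N.
  by rewrite [RHS](bigD1 0) // linear0 mxrank0 subn0 addnC.
have card_ker f : (2 ^ (m - \rank (form f)) = \sum_(u : 'rV['F_2]_m) (u *m form f == 0%R))%N.
  rewrite -card_F2_rV_kermx -sum1dep_card [LHS]big_mkcond; apply: eq_bigr => u _.
  by case: (_ == _).
under eq_bigr => f _ do rewrite card_ker.
rewrite exchange_big (bigD1 0) //=; congr (_ + _)%N.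
  under eq_bigr => f _ do rewrite mul0mx eqxx.
  by rewrite sum_nat_const muln1 card_mx card_Fp // muln1.
rewrite (eq_bigr (fun=> 2 ^ (k - 3))%N) => [|u nzu].
  by rewrite sum_nat_const -(card_F2_rV m) subn1 -(cardC1 (0 : 'rV['F_2]_m)).
rewrite -(card_null nzu) -sum1dep_card [RHS]big_mkcond; apply: eq_bigr => f _.
by case: (_ == _).
Qed.

Let D := [set f : 'cV['F_2]_k | \rank (form f) == 2%N].

Let D_neq0 f : f \in D -> f != 0.
Proof.
by rewrite inE; apply: contraTneq => ->; rewrite linear0 mxrank0.
Qed.

Let sum_null : 
  (\sum_(f : 'cV['F_2]_k | f != 0%R) 2 ^ (m - \rank (form f))
    = #|D| * 2 ^ (m - 2)
      + \sum_(f : 'cV['F_2]_k | (f != 0%R) && (f \notin D)) 2 ^ (m - \rank (form f)))%N.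
Proof.
rewrite (bigID (mem D)) /=; congr (_ + _)%N.
rewrite -sum_nat_const; apply: eq_big => [f | f].
  by apply: andb_idl; apply: D_neq0.
by case/andP=> _; rewrite inE => /eqP->.
Qed.

Let card_notD : #|[set f : 'cV['F_2]_k | (f != 0) && (f \notin D)]| = (2 ^ k - 1 - #|D|)%N.
Proof.
have -> : [set f : 'cV['F_2]_k | (f != 0) && (f \notin D)] = ~: (0 |: D).
  by apply/setP=> f; rewrite !inE negb_or.
rewrite cardsCs setCK cardsU1.
have -> : 0 \notin D by apply/negP => /D_neq0; rewrite eqxx.
by rewrite card_mx card_Fp // muln1 subnDA.
Qed.

(** Ranks are even, so a nonzero form outside [D] has rank at least 4 and a radical of dimension at
    most m - 4. *)
Let sum_null_le :
  (\sum_(f : 'cV['F_2]_k | f != 0%R) 2 ^ (m - \rank (form f))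
    <= #|D| * 2 ^ (m - 2) + (2 ^ k - 1 - #|D|) * 2 ^ (m - 4))%N.
Proof.
rewrite sum_null leq_add2l -card_notD -sum_nat_const.
under [leqRHS]eq_bigl => f do rewrite inE.
apply: leq_sum => f /andP[nzf]; rewrite inE => /(rank_form_ge4 nzf) le4.
by rewrite leq_exp2l // leq_sub2l.
Qed.

Let rank_capD (A B : 'M['F_2]_m) : (\rank A + \rank B <= \rank (A :&: B)%MS + m)%N.
Proof. by rewrite -mxrank_sum_cap addnC leq_add2l rank_leq_row. Qed.

Let rank_kerD f : f \in D -> \rank (kermx (form f)) = (m - 2)%N.
Proof. by rewrite inE mxrank_ker => /eqP->. Qed.

Let common_null (u : 'rV_m) (s : seq 'cV_k) :
  u != 0 -> uniq s -> {in s, forall f, (u <= kermx (form f))%MS} -> (size s <= 2 ^ (k - 3))%N.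
Proof.
move=> nzu /card_uniqP <- sP; rewrite -(card_null nzu); apply/subset_leq_card/subsetP=> f fs.
by rewrite inE; apply/eqP/sub_kermxP/sP.
Qed.

(* Two distinct nonzero forms have radicals meeting trivially, so at most one has rank 2;
   the count of pairs then forces m = 4. *)
Lemma forms_dim4_of4 : k = 4%N -> m = 4%N.
Proof.
move=> k4.
have disj f g : f != 0 -> g != 0 -> f != g -> (kermx (form f) :&: kermx (form g))%MS = 0.
  move=> nzf nzg neq; apply/eqP; rewrite -nz_row_eq0; apply: contraT => nzu.
  have/andP[uf ug] : ((nz_row (kermx (form f) :&: kermx (form g))%MS <= kermx (form f)) &&
    (nz_row (kermx (form f) :&: kermx (form g))%MS <= kermx (form g)))%MS.
    by rewrite -sub_capmx nz_row_sub.
  suff: (3 <= 2 ^ (k - 3))%N by rewrite k4.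
  apply: (@common_null _ [:: 0; f; g] nzu) => [|h].
    by rewrite /= !inE !negb_or !(eq_sym 0) nzf nzg neq.
  rewrite !inE => /or3P[/eqP->|/eqP->|/eqP->]; [|exact: uf|exact: ug].
  by rewrite linear0 kermx0 submx1.
have powm : (2 ^ m = 16 * 2 ^ (m - 4))%N by rewrite (_ : 16 = 2 ^ 4)%N // -expnD subnKC.
have powm2 : (2 ^ (m - 2) = 4 * 2 ^ (m - 4))%N.
  by rewrite (_ : 4 = 2 ^ 2)%N // -expnD; congr (_ ^ _)%N; lia.
have powk : (2 ^ k = 16)%N by rewrite k4.
have powk3 : (2 ^ (k - 3) = 2)%N by rewrite k4.
have lt_m : (4 < m -> 2 <= 2 ^ (m - 4))%N by move=> lt4m; rewrite (@leq_exp2l 2 1) // subn_gt0.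
apply/eqP; rewrite eqn_leq le4m andbT leqNgt; apply/negP=> lt4m.
have {}disj f g : f != 0 -> g != 0 -> f != g ->
    \rank (kermx (form f) :&: kermx (form g))%MS = 0%N.
  by move=> nzf nzg neq; rewrite disj // mxrank0.
have := count_null; have := sum_null_le; rewrite powm powm2 powk powk3.
(* With q = 2^(m - 4), the count makes the sum over nonzero forms equal to 16q + 14; without forms
   of rank 2 it would be at most 15q. *)
have [D0 | [f Df]] := set_0Vmem D; first by rewrite D0 cards0; move: (lt_m lt4m); lia.
have Df1 g : g \in D -> g = f.
  move=> Dg; apply/eqP; apply: contraTT lt4m => neq.
  have := rank_capD (kermx (form f)) (kermx (form g)).
  have := disj f g (D_neq0 Df) (D_neq0 Dg).
  rewrite eq_sym => /(_ neq); move: (rank_kerD Df) (rank_kerD Dg); lia.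
have D1 : D = [set f].
  by apply/setP=> g; rewrite in_set1; apply/idP/eqP => [/Df1 | ->].
rewrite D1 cards1 => le_sum eq_sum.
(* The radical of any other nonzero form meets that of [f], of dimension m - 2, trivially and so has
   at most 4 elements. Hence 16q + 14 <= 4q + 14 * 4, whereas 16q + 14 <= 4q + 14q demands q >=
   7. *)
have : (2 ^ (m - 4) <= 3)%N.
  suff : (\sum_(g : 'cV['F_2]_k | g != 0%R) 2 ^ (m - \rank (form g)) <= 4 * 2 ^ (m - 4) + 14 * 4)%N.
    move: eq_sum; clear; lia.
  rewrite sum_null D1 cards1 powm2 mul1n leq_add2l.
  have -> : (14 = #|[set f : 'cV['F_2]_k | (f != 0%R) && (f \notin D)]|)%N.
    by rewrite card_notD D1 cards1 powk.
  rewrite -sum_nat_const; under [leqRHS]eq_bigl => g do rewrite inE D1.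
  apply: leq_sum => g /andP[nzg]; rewrite inE => neq.
  have := rank_capD (kermx (form f)) (kermx (form g)).
  have := disj f g (D_neq0 Df) nzg.
  rewrite eq_sym => /(_ neq) cap0 le2; apply: (@leq_pexp2l 2 _ 2) => //.
  by rewrite -mxrank_ker; move: cap0 le2 (rank_kerD Df) lt4m; clear; lia.
move: le_sum eq_sum (lt_m lt4m); lia.
Qed.

(** A common nonzero null vector would be null for the five forms 0, f, g, f + g, h, but only 2^(5 -
    3) = 4 forms can share one. *)
Let independent_null f g h : k = 5%N -> f != 0 -> g != 0 -> h != 0 ->
  f != g -> h != f -> h != g -> h != f + g ->
  \rank (kermx (form f) :&: kermx (form g) :&: kermx (form h))%MS = 0%N.
Proof.
move=> k5 nzf nzg nzh fg hf hg hfg; apply/eqP; rewrite mxrank_eq0 -nz_row_eq0.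
set A := (_ :&: _)%MS; apply: contraT => nzu.
have := nz_row_sub A; set u := nz_row A => uA.
have [uf ug uh] :
    [/\ (u <= kermx (form f))%MS, (u <= kermx (form g))%MS & (u <= kermx (form h))%MS].
  by move: uA; rewrite !sub_capmx => /andP[/andP[]].
suff: (5 <= 2 ^ (k - 3))%N by rewrite k5.
apply: (@common_null _ [:: 0; f; g; f + g; h] nzu) => [|x].
  have nfg : f + g != 0 by apply: contraNneq fg => fg0; rewrite -(inj_eq (addIr g)) fg0 F2_addvv.
  have ffg : f != f + g by rewrite -[X in X != _]addr0 (inj_eq (addrI f)) eq_sym.
  have gfg : g != f + g by rewrite -[X in X != _]add0r (inj_eq (addIr g)) eq_sym.
  rewrite /= !inE !negb_or !(eq_sym 0) nzf nzg nzh nfg fg ffg gfg.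
  by rewrite (eq_sym f h) (eq_sym g h) (eq_sym _ h) hf hg hfg.
rewrite !inE => /orP[/eqP->|/or4P[]/eqP->]; [|exact: uf|exact: ug| | exact: uh].
  by rewrite linear0 kermx0 submx1.
by apply/sub_kermxP; rewrite linearD mulmxDr (sub_kermxP uf) (sub_kermxP ug) addr0.
Qed.

(** The radicals of [f] and [g] span the whole space and meet in dimension 2. On the radical of
    [f + g] the two forms agree, and their common value is annihilated by both radicals, hence is
    zero. So that radical lies in the intersection, and its dimension cannot be 4. *)
Let kerD_add f g h : k = 5%N -> m = 6%N -> f \in D -> g \in D -> h \in D ->
  f != g -> h != f -> h != g -> h != f + g -> f + g \notin D.
Proof.
move=> k5 m6 Df Dg Dh fg hf hg hfg; apply/negP=> Dfg.
have cap0 := independent_null k5 (D_neq0 Df) (D_neq0 Dg) (D_neq0 Dh) fg hf hg hfg.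
have := rank_capD (kermx (form f) :&: kermx (form g))%MS (kermx (form h)).
have := mxrank_sum_cap (kermx (form f)) (kermx (form g)).
move: cap0 (rank_kerD Df) (rank_kerD Dg) (rank_kerD Dh); set fg_cap := (_ :&: kermx (form g))%MS.
set fg_sum := (_ + kermx (form g))%MS => cap0 rf rg rh rsum rcap.
have full : (1%:M <= fg_sum)%MS.
  rewrite sub1mx; apply/eqP.
  by move: m6 cap0 rcap rsum rf rg rh (rank_leq_col fg_sum); clear; lia.
have : (kermx (form (f + g)%R) <= fg_cap)%MS.
  have eq_fg : kermx (form (f + g)) *m form f = kermx (form (f + g)) *m form g.
    apply: (addIr (kermx (form (f + g)) *m form g)).
    by rewrite F2_addvv -mulmxDr -linearD mulmx_ker.
  set X := kermx (form (f + g)) in eq_fg *; set Y := X *m form f in eq_fg.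
  have kerY h' : X *m form h' = Y -> (kermx (form h') <= kermx Y^T)%MS.
    move=> <-; apply/sub_kermxP.
    by rewrite trmx_mul tr_form mulNmx mulmxN mulmxA mulmx_ker mul0mx oppr0.
  have : (fg_sum <= kermx Y^T)%MS by rewrite addsmx_sub; apply/andP; split; apply: kerY.
  move/(submx_trans full); rewrite sub_kermx mul1mx trmx_eq0 => /eqP Y0.
  by rewrite sub_capmx; apply/andP; split; apply/sub_kermxP; rewrite -?eq_fg.
move/mxrankS; rewrite (rank_kerD Dfg); move: m6 cap0 rcap rh; clear; lia.
Qed.

Let pickD (s : seq 'cV_k) : (size s < #|D|)%N -> exists2 h, h \in D & h \notin s.
Proof.
move=> lts; apply/subsetPn; apply: contraTN lts => /subset_leq_card le.
by rewrite -leqNgt (leq_trans le) // card_size.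
Qed.

Let capK (f g : 'cV_k) := [set u : 'rV_m | u != 0 & (u <= kermx (form f) :&: kermx (form g))%MS].

Let capD_ge (f g : 'cV_k) : k = 5%N -> m = 6%N -> f \in D -> g \in D :\ f ->
  (3 <= #|capK f g|)%N.
Proof.
move=> k5 m6 Df /setD1P[gf Dg]; rewrite /capK; set A := (_ :&: _)%MS.
have le2 : (2 <= \rank A)%N.
  have := rank_capD (kermx (form f)) (kermx (form g)); rewrite -/A.
  by move: m6 (rank_kerD Df) (rank_kerD Dg); clear; lia.
have : (4 <= #|rowg A|)%N by rewrite card_rowg card_Fp // (@leq_exp2l 2 2).
rewrite (cardsD1 0) inE sub0mx add1n ltnS => /leq_trans; apply.
by apply/subset_leq_card/subsetP=> u; rewrite !inE.
Qed.

(* The count gives at least 6 forms of rank 2, and three independent ones have radicals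
   meeting trivially, so m <= 6.  For m = 5 the count fails by divisibility.  For m = 6
   there are at least 8 forms of rank 2, and the 7 pairwise disjoint sets [capK f g] of
   size at least 3 do not fit into the 15 nonzero vectors of the radical of f. *)
Lemma forms_dim4_of5 : k = 5%N -> m = 4%N.
Proof.
move=> k5.
have powm : (2 ^ m = 16 * 2 ^ (m - 4))%N by rewrite (_ : 16 = 2 ^ 4)%N // -expnD subnKC.
have powm2 : (2 ^ (m - 2) = 4 * 2 ^ (m - 4))%N.
  by rewrite (_ : 4 = 2 ^ 2)%N // -expnD; congr (_ ^ _)%N; lia.
have powk : (2 ^ k = 32)%N by rewrite k5.
have powk3 : (2 ^ (k - 3) = 4)%N by rewrite k5.
apply/eqP; rewrite eqn_leq le4m andbT leqNgt; apply/negP=> lt4m.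
have := count_null; have := sum_null_le; rewrite powm powm2 powk powk3 => le_sum eq_sum.
have q_gt0 : (0 < 2 ^ (m - 4))%N by rewrite expn_gt0.
(* With q = 2^(m - 4) and d = [#|D|], the count gives 48q + 28 <= 31q + 3dq. *)
have geD : (6 <= #|D|)%N.
  rewrite leqNgt; apply/negP=> ltD.
  have: (#|D| * 2 ^ (m - 4) <= 5 * 2 ^ (m - 4))%N by rewrite leq_mul2r -ltnS ltD orbT.
  by move: le_sum eq_sum q_gt0; rewrite mulnBl mulnCA; clear; lia.
have [f Df _] : exists2 f, f \in D & f \notin [::] by apply: pickD; apply: leq_trans geD.
have [g Dg gf] : exists2 g, g \in D & g \notin [:: f]%R by apply: pickD; apply: leq_trans geD.
have [h Dh hfg] : exists2 h, h \in D & h \notin [:: f; g; f + g].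
  by apply: pickD; apply: leq_trans geD.
have le6 : (m <= 6)%N.
  move: gf hfg; rewrite !inE !negb_or => gf /and3P[hf hg hfg].
  have cap0 := independent_null k5 (D_neq0 Df) (D_neq0 Dg) (D_neq0 Dh)
    (contra_neq (@esym _ _ _) gf) hf hg hfg.
  have := rank_capD (kermx (form f) :&: kermx (form g))%MS (kermx (form h)).
  have := rank_capD (kermx (form f)) (kermx (form g)).
  by move: cap0 (rank_kerD Df) (rank_kerD Dg) (rank_kerD Dh); clear; lia.
have [m5 | m6] : m = 5%N \/ m = 6%N by move: le6 lt4m; clear; lia.
  (* Here every nonzero form outside [D] has rank 4, and the count becomes 62 + 6d = 124. *)
  have : (\sum_(f : 'cV['F_2]_k | f != 0%R) 2 ^ (m - \rank (form f))
           = #|D| * 8 + 2 * (31 - #|D|))%N.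
    rewrite sum_null (_ : 2 ^ (m - 2) = 8)%N; last by rewrite m5.
    congr (_ + _)%N; rewrite (eq_bigr (fun=> 2 * 1))%N => [|f' /andP[nzf']]; last first.
      rewrite inE => /(rank_form_ge4 nzf'); have := even_rank_alternating (form_alt f').
      have := rank_leq_row (form f'); move: (\rank _) => r le5 ev ge4.
      suff -> : r = 4%N by rewrite m5.
      by move: m5 le5 ev ge4; clear; lia.
    by rewrite -big_distrr /= sum1dep_card card_notD powk.
  by move: eq_sum; rewrite (_ : 2 ^ (m - 4) = 2)%N ?m5 //; clear; lia.
(* Now q = 4, and the count reads 220 <= 124 + 12d. *)
have ge8 : (8 <= #|D|)%N.
  by move: le_sum eq_sum; rewrite (_ : 2 ^ (m - 4) = 4)%N ?m6 //; clear; lia.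
have : (21 <= \sum_(g in D :\ f) #|capK f g|)%N.
  apply: leq_trans (_ : \sum_(g in D :\ f) 3 <= _)%N; last first.
    by apply: leq_sum => g' Dg'; apply: capD_ge.
  by rewrite sum_nat_const; move: ge8; rewrite (cardsD1 f) Df; clear; lia.
rewrite leqNgt; case/negP; rewrite ltnS.
apply: leq_trans (_ : 15 <= _)%N => //.
have <- : #|[set u : 'rV['F_2]_m | (u != 0) && (u <= kermx (form f))%MS]| = 15%N.
  apply: succn_inj; transitivity #|rowg (kermx (form f))|; last first.
    by rewrite card_rowg card_Fp // (rank_kerD Df) m6.
  rewrite [RHS](cardsD1 0) inE sub0mx; congr (_.+1).
  by apply: eq_card => u; rewrite !inE.
rewrite -sum1dep_card.
under eq_bigr => g' _ do rewrite -sum1dep_card.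
rewrite (exchange_big_dep (fun u : 'rV_m => (u != 0) && (u <= kermx (form f))%MS)) /=; last first.
  by move=> g' u _ /andP[-> uA]; apply: submx_trans uA (capmxSl _ _).
apply: leq_sum => u /andP[nzu uf]; rewrite sum1dep_card.
apply/card_le1_eqP=> g1 g2; rewrite !inE.
move=> /and3P[/andP[g1f Dg1] _ ug1] /and3P[/andP[g2f Dg2] _ ug2].
apply/eqP; apply: contraT => g21; case/negP: nzu.
(* [h1] serves to exclude [f + g1] from [D]; then [f], [g1], [g2] are independent and their radicals
   cannot share the nonzero [u]. *)
have [h1 Dh1] : exists2 h, h \in D & h \notin [:: f; g1; f + g1].
  by apply: pickD; apply: leq_trans geD.
rewrite !inE !negb_or => /and3P[h1f h1g h1fg].
have Dg1f : f + g1 \notin D.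
  by apply: (kerD_add k5 m6 Df _ Dh1); rewrite ?inE // eq_sym.
rewrite -submx0; suff <- : (kermx (form f) :&: kermx (form g1) :&: kermx (form g2))%MS = 0.
  by rewrite sub_capmx ug1; move: ug2; rewrite sub_capmx => /andP[].
apply/eqP; rewrite -mxrank_eq0.
have [nz1 nz2] : g1 != 0 /\ g2 != 0 by split; apply: D_neq0; rewrite inE.
have g2fg1 : g2 != f + g1 by apply: contraNneq Dg1f => <-; rewrite inE.
apply/eqP/(independent_null k5 (D_neq0 Df) nz1 nz2 _ g2f _ g2fg1); first by rewrite eq_sym.
exact: g21.
Qed.

End AlternatingForms.

(** * Alternating maps whose partial maps have rank 3 *)

Section AlternatingRank3.

Variables (m k : nat) (N : {linear 'rV['F_2]_m -> 'M['F_2]_(m, k)}).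
Hypothesis rank3N : alternating_rank3 N.

Lemma rank3_skew (u v : 'rV_m) : v *m N u = u *m N v.
Proof. by have [altN _ _] := rank3N; apply: F2_alternating_sym. Qed.

Lemma rank3_card_cent (u : 'rV_m) : u != 0 -> #|[set v : 'rV_m | v *m N u == 0]| = (2 ^ (m - 3))%N.
Proof. by have [_ rankN _] := rank3N; move=> nzu; rewrite card_F2_rV_kermx rankN. Qed.

(** A nonzero [u] lies in the kernel of [N u], which has dimension m - 3; such a [u] exists because
    the values span a nonzero space. *)
Lemma rank3_dim_ge4 : (0 < k)%N -> (4 <= m)%N.
Proof.
case: k N rank3N => // k' N' [altN' rankN' spanN'] _.
have [u nzu | V0] := pickP (fun u : 'rV['F_2]_m => u != 0).
  have: (u <= kermx (N' u))%MS by rewrite sub_kermx altN'.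
  move/mxrankS; rewrite mxrank_ker rankN' // rank_rV nzu; clear; lia.
have /matrixP/(_ 0 0)/eqP : (const_mx 1 : 'cV['F_2]_k'.+1) = 0.
  by apply: spanN' => u; rewrite (eqP (negbFE (V0 u))) linear0 mul0mx.
by rewrite !mxE.
Qed.

(** Composition with functionals gives a k-dimensional space of alternating forms; for [u != 0] the
    functionals vanishing on the image of [N u] have dimension k - 3. *)
Lemma rank3_dim4_small : k = 4%N \/ k = 5%N -> m = 4%N.
Proof.
move=> k45; have [altN rankN spanN] := rank3N.
pose form : 'cV['F_2]_k -> 'M['F_2]_m := fun f => lin1_mx (trmx \o mulmxr f \o N).
have formE (u : 'rV_m) f : u *m form f = (N u *m f)^T by rewrite mul_rV_lin1.
have form_lin : linear form.
  move=> a f g; apply/row_matrixP=> i; rewrite !rowE mulmxDr -scalemxAr !formE.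
  by rewrite mulmxDr linearD -scalemxAr linearZ.
pose L := GRing.isLinear.Build _ _ _ _ form form_lin.
pose formL : {linear 'cV['F_2]_k -> 'M['F_2]_m} := HB.pack form L.
have form_alt f (u : 'rV_m) : u *m formL f *m u^T = 0.
  by rewrite formE -trmx_mul mulmxA altN mul0mx trmx0.
have form_eq0 f : formL f = 0 -> f = 0.
  by move=> f0; apply: spanN => u; apply: trmx_inj; rewrite -formE [form f]f0 mulmx0 trmx0.
have card_null (u : 'rV_m) : u != 0 -> #|[set f | u *m formL f == 0]| = (2 ^ (k - 3))%N.
  move=> nzu; rewrite -(rankN u nzu) -card_F2_cV_kermx; apply: eq_card => f.
  by rewrite !inE formE -trmx0 (inj_eq (@trmx_inj _ _ _)).
have le4m : (4 <= m)%N by apply: rank3_dim_ge4; case: k45 => ->.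
by case: k45; [apply: (forms_dim4_of4 form_alt) | apply: (forms_dim4_of5 form_alt)].
Qed.

(* If w = [v0, u0], then also w = [v0 + e, u0 + d] for all d centralising v0 and all e
   centralising u0 + d. *)
Let card_fiber (u0 v0 : 'rV_m) : v0 *m N u0 != 0 ->
  (2 ^ (m - 3) * 2 ^ (m - 3) <= \sum_u #|[set v : 'rV_m | v *m N u == v0 *m N u0]|)%N.
Proof.
move=> nzw; have nzv : v0 != 0 by apply: contraNneq nzw => ->; rewrite mul0mx.
rewrite -{1}(rank3_card_cent nzv) -sum_nat_const.
rewrite [leqRHS](reindex_inj (addrI u0)) /=.
rewrite [leqRHS](bigID [in [set d : 'rV_m | d *m N v0 == 0]]) /=.
apply: leq_trans (leq_addr _ _).
apply: leq_sum => d; rewrite inE => /eqP d0.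
have w_eq : v0 *m N (u0 + d) = v0 *m N u0.
  by rewrite linearD mulmxDr (rank3_skew d) d0 addr0.
have nzu : u0 + d != 0 by apply: contraNneq nzw => ud0; rewrite -w_eq ud0 linear0 mulmx0.
rewrite -(rank3_card_cent nzu) -(card_imset _ (addrI v0)); apply/subset_leq_card/subsetP=> v.
by case/imsetP=> e; rewrite inE => /eqP e0 ->; rewrite inE mulmxDl e0 addr0 w_eq.
Qed.

(* By [card_fiber] there are at most 56 < 2 ^ 6 - 1 nonzero commutators. *)
Lemma rank3_noncommutator :
  (6 <= k)%N -> exists2 w, w != 0 & forall u v : 'rV_m, v *m N u != w.
Proof.
move=> le6k; have le4m : (4 <= m)%N by apply: rank3_dim_ge4; lia.
pose noncomm (w : 'rV_k) := [forall u : 'rV_m, forall v : 'rV_m, v *m N u != w].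
have [w /andP[nzw wP] | allc] := pickP (fun w : 'rV_k => (w != 0) && noncomm w).
  by exists w => // u v; apply: (forallP (forallP wP u)).
have le_sum : ((2 ^ k - 1) * (2 ^ (m - 3) * 2 ^ (m - 3))
    <= \sum_(w : 'rV['F_2]_k | w != 0%R) \sum_u #|[set v : 'rV_m | v *m N u == w]|)%N.
  rewrite -(card_F2_rV k) subn1 -(cardC1 (0 : 'rV['F_2]_k)) -sum_nat_const.
  apply: leq_sum => w; rewrite inE => nzw; have := allc w; rewrite nzw /= => /negbT.
  rewrite negb_forall => /existsP[u]; rewrite negb_forall => /existsP[v].
  by rewrite negbK => /eqP w_eq; rewrite -w_eq card_fiber // w_eq.
(* Every [u] is centralised by at least q = 2^(m - 3) vectors, which leaves at most 8q (8q - q) = 56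
   q^2 pairs with nonzero commutator. *)
have sum_le : (\sum_(w : 'rV['F_2]_k | w != 0%R) \sum_u #|[set v : 'rV_m | v *m N u == w]|
    <= 2 ^ m * (2 ^ m - 2 ^ (m - 3)))%N.
  rewrite exchange_big /= -{1}(card_F2_rV m) -sum_nat_const; apply: leq_sum => u _.
  have le_cent : (2 ^ (m - 3) <= #|[set v : 'rV_m | v *m N u == 0%R]|)%N.
    have [-> | nzu] := eqVneq u 0; last by rewrite rank3_card_cent.
    by rewrite card_F2_rV_kermx linear0 mxrank0 leq_exp2l // leq_sub2l.
  apply: leq_trans (leq_sub2l (2 ^ m) le_cent).
  rewrite -(card_F2_rV m) -(cardsC [set v : 'rV_m | v *m N u == 0]) addKn.
  rewrite leq_eqVlt; apply/orP; left; apply/eqP.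
  under eq_bigr => w _ do rewrite -sum1dep_card.
  rewrite (exchange_big_dep xpredT) //= -sum1dep_card [RHS]big_mkcond; apply: eq_bigr => v _.
  rewrite inE; have [vu0 | nzvu] := eqVneq (v *m N u) 0.
    by rewrite big_pred0 // => w; rewrite vu0 eq_sym andNb.
  rewrite (big_pred1 (v *m N u)) // => w.
  by rewrite /= andbC (eq_sym _ w); case: (w =P v *m N u) => [-> | _] //=.
have powm : (2 ^ m = 8 * 2 ^ (m - 3))%N by rewrite (_ : 8 = 2 ^ 3)%N // -expnD subnKC //; lia.
have := leq_trans le_sum sum_le; rewrite powm; set q := (2 ^ (m - 3))%N.
have -> : (8 * q * (8 * q - q) = 56 * (q * q))%N.
  by rewrite -{3}[q]mul1n -mulnBl mulnACA.
rewrite leq_pmul2r ?muln_gt0 ?expn_gt0 // leqNgt; case/negP.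
have : (2 ^ 6 <= 2 ^ k)%N by rewrite leq_exp2l.
by move: (2 ^ k)%N; clear; lia.
Qed.

End AlternatingRank3.

Lemma F2_cases (a : 'F_2) : a = 0 \/ a = 1.
Proof. by case: a => [[|[|]]] // ?; [left | right]; apply/val_inj. Qed.

(** The image of [N u] meets the line spanned by [w] trivially because [w] is not a commutator, so
    the quotient map keeps the rank 3. *)
Lemma rank3_quotient m k (N : {linear 'rV['F_2]_m -> 'M['F_2]_(m, k)}) (w : 'rV_k) :
  alternating_rank3 N -> w != 0 -> (forall u v : 'rV_m, v *m N u != w) ->
  exists N' : {linear 'rV['F_2]_m -> 'M['F_2]_(m, \rank (cokermx w))}, alternating_rank3 N'.
Proof.
case=> altN rankN spanN nzw wP; pose Q := col_base (cokermx w).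
exists (mulmxr Q \o N); split=> [u | u nzu | f f0] /=; first by rewrite mulmxA altN mul0mx.
  suff cap0 : (N u :&: kermx Q)%MS = 0.
    by rewrite -(rankN u nzu) -(mxrank_mul_ker (N u) Q) cap0 mxrank0 addn0.
  apply/eqP; rewrite -nz_row_eq0; apply: contraT => nzx.
  have := nz_row_sub (N u :&: kermx Q)%MS; set x := nz_row _ in nzx *.
  rewrite sub_capmx => /andP[/submxP[v xv] /sub_kermxP xQ].
  have : (x <= w)%MS by rewrite submxE -(mulmx_base (cokermx w)) mulmxA xQ mul0mx.
  case/sub_rVP=> a xa; case: (F2_cases a) xa => -> xa; first by rewrite xa scale0r eqxx in nzx.
  by have := wP u v; rewrite -xv xa scale1r eqxx.
have /row_fullP[B BQ] := col_base_full (cokermx w).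
rewrite -[f]mul1mx -BQ -mulmxA (_ : Q *m f = 0) ?mulmx0 //.
by apply: spanN => u; rewrite mulmxA f0.
Qed.

Lemma rank3_dim4 m k (N : {linear 'rV['F_2]_m -> 'M['F_2]_(m, k)}) :
  alternating_rank3 N -> (4 <= k)%N -> m = 4%N.
Proof.
have [n] := ubnP k; elim: n k N => // n IHn k N lt_k_n rank3N le4k.
have [k45 | le6k] : (k = 4 \/ k = 5)%N \/ (6 <= k)%N by lia.
  exact: rank3_dim4_small rank3N k45.
have [w nzw wP] := rank3_noncommutator rank3N le6k.
have [N' rank3N'] := rank3_quotient rank3N nzw wP.
apply: IHn rank3N' _; rewrite mxrank_coker rank_rV nzw; move: lt_k_n le6k; clear; lia.
Qed.

(** * Adapted bases in dimension 4 *)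

Section Dimension4.

Variables (k : nat) (N : {linear 'rV['F_2]_4 -> 'M['F_2]_(4, k)}).
Hypothesis rank3N : alternating_rank3 N.

Let altN u : u *m N u = 0. Proof. by case: rank3N. Qed.

(** The centraliser of a nonzero [u] has 2^(4 - 3) elements. *)
Let centN (u v : 'rV_4) : u != 0 -> v *m N u = 0 -> v = 0 \/ v = u.
Proof.
move=> nzu vu0; have := rank3_card_cent rank3N nzu => /= card2.
have /eqP eq2 : [set 0; u] == [set v : 'rV_4 | v *m N u == 0].
  rewrite eqEcard card2 cards2 eq_sym nzu andbT; apply/subsetP=> x.
  by rewrite !inE => /orP[]/eqP->; rewrite ?mul0mx ?altN.
have : v \in [set 0; u] by rewrite eq2 inE vu0.
by rewrite !inE => /orP[]/eqP; [left | right].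
Qed.

Let planeP (x y p : 'rV['F_2]_4) : (p <= col_mx x y)%MS ->
  [\/ p = 0, p = x, p = y | p = x + y].
Proof.
rewrite -addsmxE => /sub_addsmxP[[D E] /=]; rewrite [D]mx11_scalar [E]mx11_scalar !mul_scalar_mx.
case: (F2_cases (D 0 0)) => ->; case: (F2_cases (E 0 0)) => ->;
  rewrite ?scale0r ?scale1r ?add0r ?addr0 => ->;
  by [constructor 1 | constructor 2 | constructor 3 | constructor 4].
Qed.

(** Over the field with two elements every change of basis of a plane has determinant 1, so all
    bases have the same commutator. *)
Let partner (x y p : 'rV['F_2]_4) : p != 0 -> (p <= col_mx x y)%MS ->
  exists q, [/\ q *m N p = y *m N x, (q <= col_mx x y)%MS & (x <= col_mx p q)%MS].
Proof.
move=> nzp /planeP[] pE; rewrite {}pE in nzp *; first by rewrite eqxx in nzp.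
- by exists y; rewrite -!addsmxE addsmxSl addsmxSr.
- by exists x; rewrite -!addsmxE addsmxSl addsmxSr (rank3_skew rank3N).
exists y; rewrite linearD mulmxDr altN addr0 -!addsmxE addsmxSr; split=> //.
rewrite -[x in X in (X <= _)%MS]addr0 -(F2_addvv y) addrA.
by rewrite addmx_sub_adds.
Qed.

Let rank_plane (x y : 'rV_4) : y *m N x != 0 -> \rank (col_mx x y) = 2%N.
Proof.
move=> nzw; apply/eqP; rewrite eqn_leq rank_leq_row /= ltnNge; apply: contra (nzw) => le1.
have nzx : x != 0 by apply: contraNneq nzw => ->; rewrite linear0 mulmx0.
have sx : (x <= col_mx x y)%MS by rewrite -addsmxE addsmxSl.
have : (col_mx x y <= x)%MS.
  by rewrite -(mxrank_leqif_sup sx) eqn_leq mxrankS // rank_rV nzx.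
rewrite -addsmxE addsmx_sub => /andP[_ /sub_rVP[a ->]].
by rewrite -scalemxAl altN scaler0.
Qed.

(** If [p] is a common nonzero vector with partners [q] and [r] in the two planes, then [q + r]
    centralises [p], so it is 0 or [p]. Thus [r], and with it [z], lies in the first plane. *)
Let plane_cap (x y z t : 'rV['F_2]_4) : y *m N x != 0 -> y *m N x = t *m N z ->
  ~~ (z <= col_mx x y)%MS -> (col_mx x y :&: col_mx z t)%MS = 0.
Proof.
move=> nzw eqw; apply: contraNeq; rewrite -nz_row_eq0 => nzp.
have := nz_row_sub (col_mx x y :&: col_mx z t)%MS; set p := nz_row _ in nzp *.
rewrite sub_capmx => /andP[pP pQ].
have [q [qw qP _]] := partner nzp pP.
have [r [rw _ zr]] := partner nzp pQ.
apply: submx_trans zr _; rewrite -addsmxE addsmx_sub pP /=.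
have qr0 : (q + r) *m N p = 0 by rewrite mulmxDl qw rw eqw F2_addvv.
have -> : r = q + (q + r) by rewrite addrA F2_addvv add0r.
by have [->| ->] := centN nzp qr0; rewrite ?addr0 ?addmx_sub.
Qed.

Let plane_full (x y z t : 'rV['F_2]_4) : y *m N x != 0 -> y *m N x = t *m N z ->
  ~~ (z <= col_mx x y)%MS -> row_full (col_mx (col_mx x y) (col_mx z t)).
Proof.
move=> nzw eqw zP; have := mxrank_sum_cap (col_mx x y) (col_mx z t).
rewrite (plane_cap nzw eqw zP) mxrank0 addn0 rank_plane // rank_plane -?eqw // addsmxE.
by move/eqP.
Qed.

(* Pigeonhole: 15 vectors u have 7 nonzero commutators each, and 15 * 7 > 31 * 3, so some
   w is a commutator of more vectors than the 3 of a single plane. *)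
Let hyperbolic_pair : (k <= 5)%N -> exists a b c d : 'rV['F_2]_4,
  [/\ b *m N a != 0, b *m N a = d *m N c & ~~ (c <= col_mx a b)%MS].
Proof.
move=> le5; pose S (w : 'rV['F_2]_k) := [set u : 'rV['F_2]_4 | (w <= N u)%MS].
have sumS : (\sum_(w : 'rV['F_2]_k | w != 0%R) #|S w| = 105)%N.
  under eq_bigr => w _ do rewrite -sum1dep_card.
  rewrite (exchange_big_dep xpredT) //=.
  under eq_bigr => u _ do rewrite sum1dep_card.
  rewrite (bigD1 0) //= (_ : [set w : 'rV_k | _] = set0) ?cards0 ?add0n; last first.
    apply/setP=> w; rewrite !inE; apply/negbTE/negP=> /andP[nzw /submxP[v wE]].
    by rewrite wE linear0 mulmx0 eqxx in nzw.
  rewrite (eq_bigr (fun=> 7))%N => [|u nzu].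
    rewrite sum_nat_const; have := cardC1 (0 : 'rV['F_2]_4).
    by rewrite card_F2_rV => ->.
  have : #|rowg (N u)| = 8%N by case: rank3N => _ rankN _; rewrite card_rowg card_Fp // rankN.
  rewrite (cardsD1 0) inE sub0mx add1n => /succn_inj <-.
  by apply: eq_card => w; rewrite !inE.
have [w /andP[nzw gt3]] : exists w, (w != 0) && (3 < #|S w|)%N.
  apply/existsP; apply: contraT; rewrite negb_exists => /forallP le3.
  have : (\sum_(w : 'rV['F_2]_k | w != 0%R) #|S w| <= \sum_(w : 'rV['F_2]_k | w != 0%R) 3)%N.
    by apply: leq_sum => w nzw; have := le3 w; rewrite nzw /= -leqNgt.
  rewrite sumS sum_nat_const; have := cardC1 (0 : 'rV['F_2]_k); rewrite card_F2_rV => ->.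
  have : (2 ^ k <= 2 ^ 5)%N by rewrite leq_exp2l.
  by move: (2 ^ k)%N; clear; lia.
have /card_gt0P[x xS] : (0 < #|S w|)%N by apply: leq_trans gt3.
have /submxP[y wE] : (w <= N x)%MS by rewrite inE in xS.
have [z zS zP] : exists2 z, z \in S w & ~~ (z <= col_mx x y)%MS.
  have /subsetPn[z zS zP] : ~~ (S w \subset rowg (col_mx x y) :\ 0).
    apply: contraL gt3 => /subset_leq_card; rewrite -leqNgt => /leq_trans; apply.
    have : #|rowg (col_mx x y)| = 4%N by rewrite card_rowg card_Fp // rank_plane // -wE.
    by rewrite (cardsD1 0) inE sub0mx => /succn_inj ->.
  exists z => //; move: zP; rewrite !inE negb_and negbK => /orP[/eqP z0|//].
  by move: zS; rewrite z0 inE => /submxP[v wE0]; rewrite wE0 linear0 mulmx0 eqxx in nzw.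
have /submxP[t tE] : (w <= N z)%MS by rewrite inE in zS.
by exists x, y, z, t; rewrite -wE -tE.
Qed.

Let plane_comm (x y p q : 'rV['F_2]_4) : (p <= col_mx x y)%MS -> (q <= col_mx x y)%MS ->
  q *m N p = 0 \/ q *m N p = y *m N x.
Proof.
have simp := (mulmx0, mul0mx, mulmxDr, mulmxDl, altN, rank3_skew rank3N x y,
              add0r, addr0, F2_addvv).
by case/planeP=> ->; case/planeP=> ->; rewrite ?(linear0 N) ?(linearD N) ?simp; by [left | right].
Qed.

Lemma rank3_basis5 : (k <= 5)%N -> exists a b c d : 'rV['F_2]_4,
  row_full (col_mx (col_mx a b) (col_mx c d)) /\ b *m N a = d *m N c.
Proof.
case/hyperbolic_pair=> [a [b [c [d [nzw eqw cP]]]]].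
by exists a, b, c, d; split=> //; apply: plane_full.
Qed.

(* Given [a, b] = [z, t], the map [phi] : (q, r) |-> [a, q] + [b, r] on pairs from the plane
   of z and t is injective: a kernel element with q, r independent would make
   a + r and b + q commute.  As the target has 16 elements, [phi] takes the value [a, b]. *)
Lemma rank3_basis4 : k = 4%N -> exists a b c d : 'rV['F_2]_4,
  [/\ row_full (col_mx (col_mx a b) (col_mx c d)), b *m N a = d *m N c
    & c *m N a + d *m N b + d *m N c = 0].
Proof.
move=> k4; have [|a [b [z [t [nzw eqw zP]]]]] := hyperbolic_pair; first by rewrite k4.
have aP : (a <= col_mx a b)%MS by rewrite -addsmxE addsmxSl.
have bP : (b <= col_mx a b)%MS by rewrite -addsmxE addsmxSr.
have PQ (p : 'rV['F_2]_4) : (p <= col_mx a b)%MS -> (p <= col_mx z t)%MS -> p = 0.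
  move=> pP pQ; have : (p <= col_mx a b :&: col_mx z t)%MS by rewrite sub_capmx pP.
  by rewrite (plane_cap nzw eqw zP) => /submxP[D ->]; rewrite mulmx0.
have nza : a != 0 by apply: contraNneq nzw => ->; rewrite linear0 mulmx0.
have nzb : b != 0 by apply: contraNneq nzw => ->; rewrite mul0mx.
have nzab : a + b != 0.
  by apply: contraNneq nzw => ab0; rewrite -[b]add0r -(F2_addvv a) -addrA ab0 addr0 altN.
have abP : ((a + b)%R <= col_mx a b)%MS by apply: addmx_sub.
(* Here [q + p'] centralises [p], so it is 0 or [p]; thus [q] lies in both planes. *)
have samep (p p' q : 'rV['F_2]_4) : p != 0 -> (p <= col_mx a b)%MS -> (p' <= col_mx a b)%MS ->
    (q <= col_mx z t)%MS -> q *m N p = p' *m N p -> q = 0.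
  move=> nzp pP p'P qQ eqp; apply: PQ => //.
  have qp0 : (q + p') *m N p = 0 by rewrite mulmxDl eqp F2_addvv.
  have -> : q = (q + p') + p' by rewrite -addrA F2_addvv addr0.
  by have [->|->] := centN nzp qp0; rewrite ?add0r ?addmx_sub.
have commQ (q1 q2 : 'rV['F_2]_4) : (q1 <= col_mx z t)%MS -> (q2 <= col_mx z t)%MS ->
    q1 != 0 -> q2 != 0 -> q2 != q1 -> q2 *m N q1 = b *m N a.
  move=> q1Q q2Q nz1 nz2 nz21; have [q0 | ->] := plane_comm q1Q q2Q; last by [].
  by have [q20|q21] := centN nz1 q0; [rewrite q20 eqxx in nz2 | rewrite q21 eqxx in nz21].
pose phi (q : 'rV['F_2]_4 * 'rV['F_2]_4) := q.1 *m N a + q.2 *m N b.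
have phi_eq0 (q1 q2 : 'rV['F_2]_4) : (q1 <= col_mx z t)%MS -> (q2 <= col_mx z t)%MS ->
    phi (q1, q2) = 0 -> q1 = 0 /\ q2 = 0.
  rewrite /phi /= => q1Q q2Q phi0.
  have [z1 | nz1] := eqVneq q1 0.
    split=> //; apply: (samep b 0) => //; first exact: sub0mx.
    by rewrite mul0mx -phi0 z1 mul0mx add0r.
  have [z2 | nz2] := eqVneq q2 0.
    split=> //; apply: (samep a 0) => //; first exact: sub0mx.
    by rewrite mul0mx -phi0 z2 mul0mx addr0.
  have [z12 | nz12] := eqVneq q2 q1.
    have: q1 = 0; last by move=> q10; rewrite q10 eqxx in nz1.
    apply: (samep (a + b) 0) => //; first exact: sub0mx.
    by rewrite mul0mx (linearD N) mulmxDr -phi0 z12.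
  have ab0 : (a + q2) *m N (b + q1) = 0.
    rewrite (linearD N) mulmxDr !mulmxDl (rank3_skew rank3N b a) (rank3_skew rank3N q1 a).
    rewrite (commQ q1 q2) // [X in _ + X]addrC addrACA F2_addvv add0r addrC.
    exact: phi0.
  have aq2 : a + q2 != 0.
    apply: contraNneq nza => /F2_addr_eq0 aq2; apply/eqP/PQ => //; by rewrite aq2.
  (* So [b + q1] is 0 or [a + q2]; either way a nonzero vector of the first plane lies in the
     second. *)
  have [/F2_addr_eq0 bq1 | bq1] := centN aq2 (etrans (rank3_skew rank3N _ _) ab0).
    by case/eqP: nzb; apply: PQ; rewrite // bq1.
  case/eqP: nzab; apply: PQ => //.
  have -> : a + b = q2 + q1; last exact: addmx_sub.
  by apply: F2_addr_eq0; rewrite addrACA bq1 F2_addvv.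
have card_QQ : #|setX (rowg (col_mx z t)) (rowg (col_mx z t))| = 16%N.
  by rewrite cardsX card_rowg card_Fp // rank_plane // -eqw.
have inj_phi : {in setX (rowg (col_mx z t)) (rowg (col_mx z t)) &, injective phi}.
  move=> [q1 q2] [r1 r2]; rewrite !inE /= => /andP[q1Q q2Q] /andP[r1Q r2Q] eq_phi.
  have [] := phi_eq0 (q1 + r1) (q2 + r2); rewrite ?addmx_sub //.
    by rewrite /phi /= !mulmxDl addrACA -[X in X + _]/(phi (q1, q2)) eq_phi F2_addvv.
  by move=> /F2_addr_eq0-> /F2_addr_eq0->.
have /imsetP[[q1 q2]] : b *m N a \in phi @: setX (rowg (col_mx z t)) (rowg (col_mx z t)).
  suff /eqP -> : phi @: setX (rowg (col_mx z t)) (rowg (col_mx z t)) == setT by rewrite inE.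
  rewrite eqEcard subsetT (card_in_imset inj_phi) card_QQ cardsT card_F2_rV.
  by move: k4; clear; case: k => [|[|[|[|[]]]]].
rewrite !inE /= /phi /= => /andP[q1Q q2Q] phi_w.
have nz1 : q1 != 0.
  apply: contraNneq nzw => z1; rewrite phi_w z1 mul0mx add0r.
  rewrite (_ : q2 = 0) ?mul0mx //; apply: (samep b a) => //.
  by rewrite (rank3_skew rank3N b a) phi_w z1 mul0mx add0r.
have nz2 : q2 != 0.
  apply: contraNneq nzw => z2; rewrite phi_w z2 mul0mx addr0.
  rewrite (_ : q1 = 0) ?mul0mx //; apply: (samep a b) => //.
  by rewrite phi_w z2 mul0mx addr0.
have nz21 : q2 != q1.
  apply: contraNneq nz1 => z12; apply/eqP; apply: (samep (a + b) b) => //.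
  by rewrite !(linearD N) !mulmxDr altN addr0 phi_w z12.
have w12 := commQ q1 q2 q1Q q2Q nz1 nz2 nz21.
exists a, b, q1, q2; split; rewrite ?w12 //.
  apply: plane_full; rewrite ?w12 //; apply: contra nz1 => q1P; apply/eqP; exact: PQ.
by rewrite -phi_w F2_addvv.
Qed.

End Dimension4.

Local Close Scope ring_scope.

(** * Coordinates of a group of conjugate type {1, 8} and class 2 *)

Section Class2.

Variables (gT : finGroupType) (G : {group gT}).
Hypotheses (pG : 2.-group G) (typeG : conjugate_type G [:: 1; 8]%N) (clG : nil_class G = 2).

Lemma class2_der1_sub : G^`(1) \subset 'Z(G).
Proof. by rewrite -nil_class2 clG. Qed.

Lemma class2_nonabelian : ~~ abelian G.
Proof. by rewrite -nil_class1 clG. Qed.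

Lemma commG_central x y z : x \in G -> y \in G -> z \in G -> commute z [~ x, y].
Proof.
move=> Gx Gy Gz; have /centerP[_ cxy] := subsetP class2_der1_sub _ (mem_commg Gx Gy).
by apply: commute_sym; apply: cxy.
Qed.

Lemma card_class_noncentral x : x \in G -> x \notin 'Z(G) -> #|x ^: G| = 8.
Proof.
move=> Gx; apply: contraNeq => neq8.
have : #|x ^: G| \in [:: 1; 8]%N by apply/typeG; exists x.
rewrite mem_seq2 (negPf neq8) orbF -index_cent1 => /eqP ind1.
apply/centerP; split=> // y Gy; have : y \in 'C_G[x].
  suff -> : 'C_G[x] = G by [].
  by apply/eqP; rewrite eqEsubset subsetIl -indexg_eq1 ind1.
by case/setIP=> _ /cent1P/commute_sym.
Qed.

(* Otherwise C(x) = C(x^2), but x^2 commutes with any g such that [x, g] is an involution. *)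
Lemma sqr_central x : x \in G -> x ^+ 2 \in 'Z(G).
Proof.
move=> Gx; apply: contraT => nZx2.
have nZx : x \notin 'Z(G) by apply: contra nZx2; apply: groupX.
have Gx2 : x ^+ 2 \in G by rewrite groupX.
have eqC : 'C_G[x] = 'C_G[x ^+ 2].
  apply/eqP; rewrite eqEcard; apply/andP; split.
    apply/subsetP=> y /setIP[Gy /cent1P cxy].
    by apply/setIP; split=> //; apply/cent1P; apply: commuteX.
  have i1 := index_cent1 G x; have i2 := index_cent1 G (x ^+ 2).
  rewrite card_class_noncentral // in i1; rewrite card_class_noncentral // in i2.
  have c1 := Lagrange (subsetIl G 'C[x]); have c2 := Lagrange (subsetIl G 'C[x ^+ 2]).
  by rewrite i1 in c1; rewrite i2 in c2; rewrite -(@leq_pmul2r 8) // c1 c2.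
have /subsetPn[g Gg ncg] : ~~ (G \subset 'C_G[x]).
  apply: contra nZx => sGC; apply/centerP; split=> // y Gy.
  by have /setIP[_ /cent1P/commute_sym] := subsetP sGC y Gy.
have ntc : [~ x, g] != 1.
  by apply: contra ncg => /commgP cxg; apply/setIP; split=> //; apply/cent1P/commute_sym.
set c := [~ x, g] in ntc.
have Gc : c \in G by rewrite groupR.
have dvd2 : 2 %| #[c].
  have := mem_p_elt pG Gc; rewrite /p_elt => /p_natP[[|e] oc]; last by rewrite oc dvdn_exp.
  by case/eqP: ntc; apply/eqP; rewrite -order_eq1 oc.
(* Commutators are multiplicative in class 2, so this power of [g] replaces [c] by the involution of
   its cyclic group. *)
have cgX : [~ x, g ^+ (#[c] %/ 2)] = c ^+ (#[c] %/ 2) by rewrite commgX //; apply: commG_central.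
have : g ^+ (#[c] %/ 2) \in 'C_G[x ^+ 2].
  apply/setIP; split; [exact: groupX | apply/cent1P/commute_sym/commgP]; rewrite commXg; last first.
    by apply: commG_central; rewrite ?groupX.
  by rewrite cgX -expgM divnK // expg_order.
rewrite -eqC => /setIP[_ /cent1P/commute_sym/commgP]; rewrite cgX -order_dvdn.
have oc_gt1 : (1 < #[c])%N by rewrite ltnNge -trivg_card_le1 cycle_eq1.
by rewrite gtnNdvd // ?divn_gt0 ?ltn_Pdiv.
Qed.

(** In class 2, [x, y]^2 = [x^2, y], and squares are central. *)
Lemma der1_sqr : {in G^`(1), forall x, x ^+ 2 = 1}.
Proof.
have abG' : abelian G^`(1) by rewrite (abelianS class2_der1_sub) ?center_abelian.
rewrite derg1 in abG' *; apply: gen_exponent2 abG' _.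
move=> _ /imset2P[x y Gx Gy ->]; rewrite -commXg; last exact: commG_central.
by apply/eqP/commgP; have /centerP[_] := sqr_central Gx; apply.
Qed.

Lemma quotient_center_abelem : 2.-abelem (G / 'Z(G)).
Proof.
apply/abelemP=> //; split=> [|_ /morphimP[x Nx Gx ->]].
  by apply: sub_der1_abelian; apply: class2_der1_sub.
by rewrite -morphX //= coset_id // sqr_central.
Qed.

Lemma der1_abelem : 2.-abelem G^`(1).
Proof.
apply/abelemP=> //; split; last exact: der1_sqr.
by rewrite (abelianS class2_der1_sub) ?center_abelian.
Qed.

Lemma quotient_center_neq1 : (G / 'Z(G))%G :!=: 1.
Proof.
rewrite -subG1 quotient_sub1 ?(normal_norm (center_normal G)) //.
apply: contra class2_nonabelian => sGZ; exact: abelianS sGZ (center_abelian G).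
Qed.

Lemma der1_neq1 : G^`(1)%G :!=: 1.
Proof. by apply: contra class2_nonabelian => /eqP/derG1P. Qed.

End Class2.

Local Open Scope ring_scope.

Lemma F2_additive_linear (U V : lmodType 'F_2) (f : U -> V) :
  {morph f : u v / u + v} -> linear f.
Proof.
move=> fD a u v; have f0 : f 0 = 0 by apply: (addrI (f 0)); rewrite -fD !addr0.
by rewrite fD; case: (F2_cases a) => ->; rewrite ?scale1r // !scale0r f0.
Qed.

Lemma F2_biadditive_mx m k (c : 'rV['F_2]_m -> 'rV['F_2]_m -> 'rV['F_2]_k) :
  (forall v, {morph (c^~ v) : u u' / u + u'}) -> (forall u, {morph (c u) : v v' / v + v'}) ->
  exists N : {linear 'rV['F_2]_m -> 'M['F_2]_(m, k)}, forall u v, v *m N u = c v u.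
Proof.
move=> cl cr; pose N0 u := lin1_mx (c^~ u) : 'M['F_2]_(m, k).
have N0E u v : v *m N0 u = c v u.
  pose L := GRing.isLinear.Build _ _ _ _ (c^~ u) (F2_additive_linear (cl u)).
  pose f : {linear 'rV['F_2]_m -> 'rV['F_2]_k} := HB.pack (c^~ u) L.
  exact: (mul_rV_lin1 f).
have N0D : {morph N0 : u v / u + v}.
  by move=> u v; apply/row_matrixP=> i; rewrite !rowE mulmxDr !N0E cr.
pose L := GRing.isLinear.Build _ _ _ _ N0 (F2_additive_linear N0D).
by exists (HB.pack N0 L : {linear 'rV['F_2]_m -> 'M['F_2]_(m, k)}) => u v; apply: N0E.
Qed.

(* X lifts G / 'Z(G), identified with the row vectors of length m, to G; Y identifies the
   row vectors of length k with G^`(1). *)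
Record commutator_coordinates (gT : finGroupType) (G : {group gT}) m k
    (X : 'rV['F_2]_m -> gT) (Y : 'rV['F_2]_k -> gT)
    (N : {linear 'rV['F_2]_m -> 'M['F_2]_(m, k)}) : Prop := CommutatorCoordinates {
  coord_rank3 : alternating_rank3 N;
  coord_in u : X u \in G;
  coord_repr g : g \in G -> exists u, g \in (X u *: 'Z(G))%g;
  coordD u v : X (u + v) \in ((X u * X v)%g *: 'Z(G))%g;
  coord_der_inj : injective Y;
  coord_derD w w' : Y (w + w') = (Y w * Y w')%g;
  coord_der : Y @: setT = G^`(1)%g;
  coord_comm u v : [~ X u, X v]%g = Y (u *m N v) }.

Lemma class2_coordinates (gT : finGroupType) (G : {group gT}) :
  2.-group G -> conjugate_type G [:: 1; 8]%N -> nil_class G = 2%N ->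
  exists m k X Y N, @commutator_coordinates gT G m k X Y N.
Proof.
move=> pG typeG clG.
pose abV := quotient_center_abelem pG typeG clG; pose ntV := quotient_center_neq1 clG.
pose abW := der1_abelem pG typeG clG; pose ntW := der1_neq1 clG.
pose rV := rVabelem abV ntV; pose rW := rVabelem abW ntW; pose eW := abelem_rV abW ntW.
pose X u := repr (rV u : coset_of 'Z(G)).
have nZ := normal_norm (center_normal G).
have cosetX u : coset 'Z(G) (X u) = rV u by rewrite coset_reprK.
have NX u : X u \in 'N('Z(G))%g by apply: repr_coset_norm.
have GX u : X u \in G.
  by rewrite -(quotientGK (center_normal G)) mem_morphpre ?NX //= cosetX mem_rVabelem.
have Xrep g h : g \in G -> h \in G -> coset 'Z(G) g = coset 'Z(G) h -> h \in (g *: 'Z(G))%g.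
  move=> Gg Gh eqgh; rewrite -norm_rlcoset; last exact: (subsetP nZ).
  by rewrite -val_coset ?(subsetP nZ) // eqgh val_coset ?(subsetP nZ) // rcoset_refl.
have XD u v : X (u + v) \in ((X u * X v)%g *: 'Z(G))%g.
  apply: Xrep; rewrite ?groupM //.
  by rewrite morphM ?NX //= !cosetX /rV rVabelemD.
have commXD u v g : g \in G -> [~ X (u + v), g]%g = ([~ X u, g] * [~ X v, g])%g.
  move=> Gg; have /lcosetP[z Zz ->] := XD u v.
  rewrite -[g in LHS]mulg1 (commg_mulZ (groupM (GX u) (GX v)) Gg Zz (group1 _)).
  by rewrite commMgJ conjgE -(commG_central clG (GX u) Gg (GX v)) mulKg.
have DX u v : [~ X u, X v]%g \in G^`(1)%g by rewrite mem_commg.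
pose c u v := eW [~ X u, X v]%g.
have cl v : {morph (c^~ v) : u u' / u + u'}.
  by move=> u u'; rewrite /c commXD // /eW abelem_rV_M.
have c_inv u v : c u v = c v u.
  rewrite /c /eW -invg_comm abelem_rV_V //.
  by apply/esym/eqP; rewrite -addr_eq0 F2_addvv.
have cr u : {morph (c u) : v v' / v + v'} by move=> v v'; rewrite !(c_inv u) cl.
have [N NE] := F2_biadditive_mx cl cr.
have commE u v : [~ X u, X v]%g = rW (u *m N v).
  by rewrite NE /c /rW /eW abelem_rV_K.
have Xall g : g \in G -> exists u, g \in (X u *: 'Z(G))%g.
  move=> Gg; exists (abelem_rV abV ntV (coset 'Z(G) g)); apply: Xrep => //.
  by rewrite cosetX /rV abelem_rV_K // mem_quotient.
have rWG : rW @: setT = G^`(1)%g.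
  apply/setP=> y; apply/imsetP/idP => [[w _ ->] | Wy]; first exact: mem_rVabelem.
  by exists (eW y); rewrite // /rW /eW abelem_rV_K.
have commE' u v : rW (v *m N u) = [~ X u, X v]%g.
  by rewrite NE c_inv /c /rW /eW abelem_rV_K.
exists _, _, X, rW, N; split=> //; [split | exact: rVabelem_inj | exact: rVabelemD].
- by move=> u; rewrite NE /c commgg /eW abelem_rV_1.
(* The class of [X u] is [X u] times the image under [rW] of the row space of [N u]; it has 8
   elements, so the row space has dimension 3. *)
- move=> u nzu; apply/eqP; rewrite -(@eqn_exp2l 2) //; apply/eqP.
  have nZXu : X u \notin 'Z(G)%g.
    apply: contra nzu => /coset_id; rewrite cosetX => rV1.
    by apply/eqP/(@rVabelem_inj _ _ _ abV ntV); rewrite rVabelem0.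
  rewrite -[RHS]/8%N -(card_class_noncentral typeG (GX u) nZXu).
  have := card_rowg (N u); rewrite card_Fp // => <-.
  rewrite -(card_imset _ (@rVabelem_inj _ _ _ abW ntW)) -(card_lcoset _ (X u)).
  apply: eq_card => y; apply/lcosetP/imsetP.
    case=> _ /imsetP[w + ->] ->; rewrite inE => /submxP[v ->].
    by exists (X v) => //; rewrite -/rW commE' conjg_mulR.
  case=> g Gg ->; have [v /lcosetP[z Zz ->]] := Xall g Gg.
  exists (rW (v *m N u)); first by rewrite imset_f // inE submxMl.
  rewrite commE' conjg_mulR; congr (_ * _)%g.
  by rewrite -{1}[X u]mulg1 (commg_mulZ (GX u) (GX v) (group1 _) Zz).
(* The elements of G' killed by [f] form a subgroup containing all commutators, hence all of G'. *)
- move=> f f0; have grK : group_set [set y in G^`(1)%g | eW y *m f == 0].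
    apply/group_setP; split=> [|x y].
      by rewrite inE group1 /eW abelem_rV_1 mul0mx eqxx.
    rewrite !inE => /andP[Wx /eqP x0] /andP[Wy /eqP y0].
    by rewrite groupM //= /eW abelem_rV_M // mulmxDl x0 y0 addr0.
  have sWK : [~: G, G]%g \subset Group grK.
    rewrite gen_subG; apply/subsetP=> _ /imset2P[x y Gx Gy ->].
    have [u /lcosetP[z Zz ->]] := Xall x Gx; have [v /lcosetP[t Zt ->]] := Xall y Gy.
    by rewrite (commg_mulZ (GX u) (GX v) Zz Zt) inE DX /= -/(c u v) -NE -mulmxA f0 mulmx0.
  apply/row_matrixP=> i; rewrite row0 rowE.
  have := subsetP sWK (rW (delta_mx 0 i)) (mem_rVabelem abW ntW _).
  by rewrite inE /eW /rW rVabelemK => /andP[_ /eqP].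
Qed.

(** * The Camina case *)

Record biadditive (U W : zmodType) (beta : U -> U -> W) : Prop := Biadditive {
  biaddl v : {morph (beta^~ v) : u u' / u + u'};
  biaddr u : {morph (beta u) : v v' / v + v'} }.

(** The proof of biadditivity is an argument of the type so that the group structure, whose laws
    rest on it, can be attached to the type itself. *)
Definition central_ext m k (beta : 'rV['F_2]_m -> 'rV['F_2]_m -> 'rV['F_2]_k)
  of biadditive beta : Type := ('rV['F_2]_m * 'rV['F_2]_k)%type.

Section CentralExtension.

Variables (m k : nat) (beta : 'rV['F_2]_m -> 'rV['F_2]_m -> 'rV['F_2]_k).
Hypothesis biadd : biadditive beta.

Local Notation E := (central_ext biadd).

Definition cext_mul (x y : E) : E := (x.1 + y.1, x.2 + y.2 + beta x.1 y.1).
Definition cext_inv (x : E) : E := (x.1, x.2 + beta x.1 x.1).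
Definition cext_one : E := (0, 0).

Lemma cext_mulA : associative cext_mul.
Proof.
move=> x y z; congr (_, _); rewrite /= ?addrA //.
rewrite (biaddl biadd) (biaddr biadd) -!addrA; congr (_ + (_ + _)).
by rewrite [RHS]addrCA [beta _ _ + (beta _ _ + _)]addrC -addrA.
Qed.

Lemma cext_mul1 : left_id cext_one cext_mul.
Proof.
move=> [u w]; congr (_, _); rewrite /= !add0r //.
suff -> : beta 0 u = 0 by rewrite addr0.
by apply: (addrI (beta 0 u)); rewrite -(biaddl biadd) !addr0.
Qed.

Lemma cext_mulV : left_inverse cext_one cext_inv cext_mul.
Proof. by move=> [u w]; congr (_, _); rewrite /= ?F2_addvv // -addrA F2_addvv. Qed.

HB.instance Definition _ := Finite.copy E ('rV['F_2]_m * 'rV['F_2]_k)%type.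
HB.instance Definition _ := Finite_isGroup.Build E cext_mulA cext_mul1 cext_mulV.

Lemma cextM (x y : E) : (x * y)%g = (x.1 + y.1, x.2 + y.2 + beta x.1 y.1) :> E.
Proof. by []. Qed.

Lemma cext_comm (x y : E) : [~ x, y]%g = (0, beta x.1 y.1 + beta y.1 x.1) :> E.
Proof.
apply: (mulgI (y * x)%g); rewrite -commgC !cextM /=; congr (_, _).
  by rewrite addr0 addrC.
have beta0 u : beta u 0 = 0 by apply: (addrI (beta u 0)); rewrite -(biaddr biadd) !addr0.
rewrite beta0 addr0 [beta x.1 y.1 + _]addrC -!addrA (addrA (beta y.1 x.1)) F2_addvv add0r.
by rewrite addrCA.
Qed.

End CentralExtension.

(** [beta] is the strictly lower triangular half of the map: symmetrising restores the off-diagonal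
    terms, and the diagonal ones vanish. As a cocycle, [beta] yields the commutator [u *m N v]. *)
Lemma F2_alternating_polarize m k (N : {linear 'rV['F_2]_m -> 'M['F_2]_(m, k)}) :
  (forall u, u *m N u = 0) ->
  exists2 beta, biadditive beta & forall u v : 'rV_m, beta u v + beta v u = u *m N v.
Proof.
move=> altN; pose c (i j : 'I_m) : 'rV['F_2]_k := delta_mx 0 i *m N (delta_mx 0 j).
pose beta (u v : 'rV['F_2]_m) := \sum_(i < m) \sum_(j < m | (j < i)%N) (u 0 i * v 0 j) *: c i j.
have skew := F2_alternating_sym altN.
exists beta.
  split=> [v u u' | u v v'].
    rewrite /beta -big_split; apply: eq_bigr => i _; rewrite -big_split; apply: eq_bigr => j _.
    by rewrite mxE mulrDl scalerDl.
  rewrite /beta -big_split; apply: eq_bigr => i _; rewrite -big_split; apply: eq_bigr => j _.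
  by rewrite mxE mulrDr scalerDl.
move=> u v; have -> : (u : 'rV_m) *m N v = \sum_(i < m) \sum_(j < m) (u 0 i * v 0 j) *: c i j.
  rewrite {1}(row_sum_delta u) mulmx_suml; apply: eq_bigr => i _.
  rewrite {1}(row_sum_delta v) linear_sum mulmx_sumr; apply: eq_bigr => j _.
  by rewrite linearZ -scalemxAl -scalemxAr scalerA.
have -> : beta v u = \sum_(i < m) \sum_(j < m | (i < j)%N) (u 0 i * v 0 j) *: c i j.
  rewrite /beta (exchange_big_dep xpredT) //=; apply: eq_bigr => i _; apply: eq_bigr => j _.
  by rewrite mulrC /c skew.
rewrite /beta -big_split; apply: eq_bigr => i _.
rewrite [RHS](bigID (fun j : 'I_m => (j < i)%N)) /=; congr (_ + _).
rewrite [RHS](bigD1 i) ?ltnn //= /c altN scaler0 add0r; apply: eq_bigl => j.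
by rewrite -leqNgt ltn_neqAle andbC eq_sym.
Qed.

Section Camina.

Variables (gT : finGroupType) (G : {group gT}) (m k : nat).
Variables (X : 'rV['F_2]_m -> gT) (Y : 'rV['F_2]_k -> gT).
Variables (N : {linear 'rV['F_2]_m -> 'M['F_2]_(m, k)}).
Hypothesis coordG : commutator_coordinates G X Y N.
Variables (beta : 'rV['F_2]_m -> 'rV['F_2]_m -> 'rV['F_2]_k) (biadd : biadditive beta).
Hypothesis betaE : forall u v : 'rV_m, beta u v + beta v u = u *m N v.

Local Notation E := (central_ext biadd).
Local Notation C := [set: E]%G.

Let commE (x y : E) : [~ x, y]%g = (0, x.1 *m N y.1) :> E.
Proof. by rewrite cext_comm betaE. Qed.

(** [L] is the fibre product of [G] and the extension over V. Its derived subgroup lies in the set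
    [D] of pairs (Y w, (0, w)), the graph of the injection [Y], on which both projections are
    injective. *)
Lemma isoclinic_central_ext : isoclinic G C.
Proof.
have [_ GX Xall XD Yinj YD _ XY] := coordG.
pose L := [set z : gT * E | z.1 \in (X z.2.1 *: 'Z(G))%g].
have grL : group_set L.
  apply/group_setP; split=> [|[g x] [h y]].
    rewrite inE /=; have := XD 0 0; rewrite addr0 => /lcosetP[z Zz].
    rewrite -mulgA -[LHS]mulg1 => /mulgI/esym/eqP; rewrite -eq_invg_mul => /eqP eqz.
    by rewrite mem_lcoset mulg1 groupV -groupV eqz.
  rewrite !inE /= => /lcosetP[z Zz ->] /lcosetP[t Zt ->].
  have /lcosetP[r Zr eqr] := XD x.1 y.1; have [_ cz] := centerP _ _ Zz.
  apply/lcosetP; exists (r^-1 * (z * t))%g; first by rewrite !groupM ?groupV.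
  by rewrite eqr -!mulgA mulKVg (mulgA z) (cz _ (GX y.1)) -mulgA.
have Y0 : Y 0 = 1%g by apply: (mulgI (Y 0)); rewrite -YD addr0 mulg1.
have beta00 : beta 0 0 = 0.
  by apply: (addrI (beta 0 0)); rewrite -(biaddl biadd) !addr0.
pose D := [set z : gT * E | (z.2.1 == 0) && (z.1 == Y z.2.2)].
have grD : group_set D.
  apply/group_setP; split=> [|[g x] [h y]]; rewrite !inE /=.
    by apply/andP; split=> //; apply/eqP/esym.
  move=> /andP[/eqP x0 /eqP ->] /andP[/eqP y0 /eqP ->].
  by rewrite x0 y0 add0r beta00 addr0 YD !eqxx.
have sL'D : (Group grL)^`(1)%g \subset D.
  rewrite -[D]/(gval (Group grD)) derg1 gen_subG.
  have memLP z : z \in L -> exists2 t, t \in 'Z(G)%g & z.1 = (X z.2.1 * t)%g.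
    by rewrite inE => /lcosetP.
  apply/subsetP=> _ /imset2P[[g x] [h y] /memLP[z Zz /= ->] /memLP[t Zt /= ->] ->].
  have -> : [~ (X x.1 * z, x), (X y.1 * t, y)]%g = ([~ X x.1 * z, X y.1 * t], [~ x, y])%g by [].
  by rewrite inE (commg_mulZ (GX _) (GX _) Zz Zt) XY commE /= !eqxx.
have sLT := subsetT L.
pose p := restrm_morphism (subsetT (Group grL)) (fst_morphism gT E).
pose q := restrm_morphism (subsetT (Group grL)) (snd_morphism gT E).
have memL u w : (X u, (u, w) : E) \in Group grL by rewrite inE /= lcoset_refl.
apply: (@isoclinic_of_graph _ _ _ G C (Group grL) p q).
- apply/subsetP=> _ /morphimP[[g x] _ + ->]; rewrite inE /= => /lcosetP[z Zz ->].
  by rewrite groupM // (subsetP (center_sub G)).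
- apply/subsetP=> g /Xall[u /lcosetP[z Zz ->]]; apply: mem_mulg => //.
  by apply/morphimP; exists (X u, (u, 0) : E).
- apply/trivgP/subsetP=> [[g x]] /setIP[ker /(subsetP sL'D)].
  rewrite inE /= => /andP[/eqP x0 /eqP gY]; move: ker; rewrite !inE /= => /andP[_ /eqP g1].
  have {}g1 : g = 1%g := g1.
  have x20 : x.2 = 0 by apply: Yinj; rewrite -gY Y0.
  by rewrite g1 [x]surjective_pairing x0 x20.
- exact: subsetT.
- apply/subsetP=> x _; rewrite -[x]mulg1; apply: mem_mulg; last exact: group1.
  by apply/morphimP; exists (X x.1, x); rewrite // [x]surjective_pairing.
apply/trivgP/subsetP=> [[g x]] /setIP[ker /(subsetP sL'D)].
rewrite inE /= => /andP[/eqP x0 /eqP gY]; move: ker; rewrite !inE /= => /andP[_ /eqP x1].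
have {}x1 : x = 1%g := x1.
by rewrite gY x1; apply/eqP; apply: (congr1 (fun g => (g, 1%g : E)) Y0).
Qed.

Hypothesis k3 : k = 3%N.

Let row_fullN u : u != 0 -> row_full (N u).
Proof.
have [[_ rankN _] _ _ _ _ _ _ _] := coordG.
by rewrite /row_full => /rankN ->; rewrite k3.
Qed.

Let nzu : exists u : 'rV['F_2]_m, u != 0.
Proof.
have [rank3N _ _ _ _ _ _ _] := coordG; have le4m := rank3_dim_ge4 rank3N.
rewrite k3 in le4m; have {le4m}lt0m : (0 < m)%N by apply: leq_trans (le4m _).
exists (delta_mx 0 (Ordinal lt0m)); apply/eqP=> /matrixP/(_ 0 (Ordinal lt0m))/eqP.
by rewrite !mxE !eqxx oner_eq0.
Qed.

(** When k = 3, [N u] is onto for any nonzero [u], so the commutators with (u, 0) already fill the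
    second factor. *)
Lemma der1_central_ext : C^`(1)%g = [set x : E | x.1 == 0].
Proof.
have grD : group_set [set x : E | x.1 == 0].
  apply/group_setP; split=> [|x y]; rewrite !inE // => /eqP x0 /eqP y0.
  by rewrite cextM /= x0 y0 addr0.
apply/eqP; rewrite eqEsubset; apply/andP; split.
  suff: [~: C, C]%g \subset Group grD by [].
  by rewrite gen_subG; apply/subsetP=> _ /imset2P[x y _ _ ->]; rewrite inE commE.
have [u /row_fullN/submx_full full] := nzu; apply/subsetP=> [[x w]]; rewrite inE /= => /eqP ->.
have /submxP[v ->] := full _ w.
have -> : (0, v *m N u) = [~ ((v, 0) : E), ((u, 0) : E)]%g :> E by rewrite commE.
by rewrite mem_commg ?inE.
Qed.

Lemma card_der1_central_ext : #|C^`(1)%g| = 8%N.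
Proof.
rewrite der1_central_ext.
have -> : [set x : E | x.1 == 0] = [set ((0, w) : E) | w in [set: 'rV['F_2]_k]].
  apply/setP=> [[u w]]; rewrite inE; apply/eqP/imsetP => [/= -> | [w' _ [-> _]]] //.
  by exists w; rewrite ?inE.
by rewrite card_imset => [|w w' []//]; rewrite cardsT card_F2_rV k3.
Qed.

Lemma Camina_central_ext : Camina C.
Proof.
move=> x /setDP[_]; rewrite der1_central_ext inE => nzx.
have [rank3N _ _ _ _ _ _ _] := coordG.
apply/setP=> y; apply/imsetP/lcosetP => [[g _ ->] | [z]].
  by exists [~ x, g]%g; rewrite ?conjg_mulR // inE commE.
case: z => z w; rewrite inE /= => /eqP -> ->.
have /submxP[v ->] := submx_full w (row_fullN nzx).
exists ((v, 0) : E); rewrite ?inE // conjg_mulR; congr (_ * _)%g.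
by rewrite commE /= (rank3_skew rank3N).
Qed.

Lemma pgroup_central_ext : 2.-group C.
Proof.
rewrite /pgroup cardsT -[#|_|]/#|{: 'rV['F_2]_m * 'rV['F_2]_k}|.
by rewrite card_prod !card_F2_rV -expnD pnatX.
Qed.

End Camina.

Local Close Scope ring_scope.

(** * The classification *)

Definition commutators4 (gT : finGroupType) (a b c d : gT) : seq gT :=
  [:: [~ a, b]; [~ a, c]; [~ a, d]; [~ b, c]; [~ b, d]; [~ c, d]].

Lemma commg_set4_sub (gT : finGroupType) (a b c d : gT) (D : {group gT}) :
  {subset commutators4 a b c d <= D} ->
  commg_set [set a; b; c; d] [set a; b; c; d] \subset D.
Proof.
move=> sD; have comm x y : [~ x, y] \in commutators4 a b c d -> [~ x, y] \in D /\ [~ y, x] \in D.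
  by move/sD=> Dxy; split=> //; rewrite -invg_comm groupV.
have [[ab ba] [ac ca]] : ([~ a, b] \in D /\ [~ b, a] \in D) /\ ([~ a, c] \in D /\ [~ c, a] \in D).
  by split; apply: comm; rewrite !inE eqxx ?orbT.
have [[ad da] [bc cb]] : ([~ a, d] \in D /\ [~ d, a] \in D) /\ ([~ b, c] \in D /\ [~ c, b] \in D).
  by split; apply: comm; rewrite !inE eqxx ?orbT.
have [[bd db] [cd dc]] : ([~ b, d] \in D /\ [~ d, b] \in D) /\ ([~ c, d] \in D /\ [~ d, c] \in D).
  by split; apply: comm; rewrite !inE eqxx ?orbT.
apply/subsetP=> _ /imset2P[x y + + ->]; rewrite !inE -!orbA.
by case/or4P=> /eqP->; case/or4P=> /eqP->; rewrite ?commgg ?group1.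
Qed.

(** The list [s] holds commutators that generate the others. Both derived subgroups must have
    2^(size s) elements, so each relation valid in both groups lowers the bound. *)
Lemma isoclinic_of_quadruples (gT hT : finGroupType) (G : {group gT}) (H : {group hT})
    (a b c d : gT * hT) (s : seq (gT * hT)) :
  {in G^`(1), forall x, x ^+ 2 = 1} -> G^`(1) \subset 'Z(G) ->
  {in H^`(1), forall x, x ^+ 2 = 1} -> H^`(1) \subset 'Z(H) ->
  [set a; b; c; d] \subset setX G H ->
  G \subset <<[set a.1; b.1; c.1; d.1]>> * 'Z(G) ->
  H \subset <<[set a.2; b.2; c.2; d.2]>> * 'Z(H) ->
  {subset s <= commutators4 a b c d} ->
  {subset commutators4 a b c d <= <<[set x in s]>>} ->
  (2 ^ size s <= #|G^`(1)|)%N -> (2 ^ size s <= #|H^`(1)|)%N -> isoclinic G H.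
Proof.
move=> G2 cG H2 cH sS GS HS s_sub comm_sub leG leH.
have le_s : (2 ^ #|[set x in s]| <= 2 ^ size s)%N by rewrite leq_exp2l // cardsE card_size.
apply: (@isoclinic_of_generators _ _ G H [set a; b; c; d] [set x in s]) => //.
- by rewrite !imsetU !imset_set1.
- by rewrite !imsetU !imset_set1.
- apply/subsetP=> x; rewrite inE => /s_sub.
  have aS : a \in <<[set a; b; c; d]>> by rewrite mem_gen // !inE eqxx.
  have bS : b \in <<[set a; b; c; d]>> by rewrite mem_gen // !inE eqxx ?orbT.
  have cS : c \in <<[set a; b; c; d]>> by rewrite mem_gen // !inE eqxx ?orbT.
  have dS : d \in <<[set a; b; c; d]>> by rewrite mem_gen // !inE eqxx ?orbT.
  by rewrite !inE => /or4P[/eqP->|/eqP->|/eqP->|/or3P[]/eqP->]; apply: mem_commg.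
- exact: commg_set4_sub.
- exact: leq_trans le_s leG.
exact: leq_trans le_s leH.
Qed.

Section Quotient.

Variables (gT : finGroupType) (K M : {group gT}).
Hypotheses (K2 : {in K^`(1), forall x, x ^+ 2 = 1}) (cK : K^`(1) \subset 'Z(K)).
Hypothesis sMK' : M \subset K^`(1).

Lemma normal_sub_der1 : M <| K.
Proof. by rewrite sub_center_normal // (subset_trans sMK'). Qed.

Let nMK : K \subset 'N(M). Proof. exact: normal_norm normal_sub_der1. Qed.

Lemma quotient_der1_sqr : {in (K / M)^`(1), forall x, x ^+ 2 = 1}.
Proof.
rewrite -quotient_der // => _ /morphimP[x Nx K'x ->].
by rewrite -morphX // K2 // morph1.
Qed.

Lemma quotient_der1_central : (K / M)^`(1) \subset 'Z(K / M).
Proof.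
rewrite -quotient_der // subsetI quotientS ?der_sub //=.
apply: quotient_cents; exact: subset_trans cK (subsetIr _ _).
Qed.

Lemma card_quotient_der1 n : (#|M| <= n)%N -> (#|K^`(1)| <= n * #|(K / M)^`(1)|)%N.
Proof.
move=> leMn; rewrite -quotient_der // card_quotient; last first.
  exact: subset_trans (der_sub 1 K) nMK.
by rewrite -(Lagrange sMK') leq_mul2r leMn orbT.
Qed.

Lemma quotient_comm_eq a b c d : a \in K -> b \in K -> c \in K -> d \in K ->
  [~ a, b] * [~ c, d] \in M ->
  [~ coset M a, coset M b] = [~ coset M c, coset M d].
Proof.
move=> Ka Kb Kc Kd Mabcd; have nM x : x \in K -> x \in 'N(M) by apply: (subsetP nMK).
have [Nab Ncd] : [~ a, b] \in 'N(M) /\ [~ c, d] \in 'N(M) by split; apply: nM; apply: groupR.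
rewrite -!morphR ?nM //=; apply: (mulIg (coset M [~ c, d])); rewrite -!morphM //=.
have cd2 : [~ c, d] * [~ c, d] = 1 by apply: (K2 (mem_commg Kc Kd)).
by rewrite coset_id // cd2 morph1.
Qed.

Lemma quotient_comm_prod3 a b c d : a \in K -> b \in K -> c \in K -> d \in K ->
  [~ a, c] * [~ b, d] * [~ c, d] \in M ->
  [~ coset M a, coset M c] * [~ coset M b, coset M d] * [~ coset M c, coset M d] = 1.
Proof.
move=> Ka Kb Kc Kd Mprod; have nM x : x \in K -> x \in 'N(M) by apply: (subsetP nMK).
have [Nac Nbd Ncd] : [/\ [~ a, c] \in 'N(M), [~ b, d] \in 'N(M) & [~ c, d] \in 'N(M)].
  by split; apply: nM; apply: groupR.
rewrite -!morphR ?nM //= -(morphM _ Nac Nbd) -(morphM _ (groupM Nac Nbd) Ncd) /=.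
exact: coset_id.
Qed.

Lemma quotient_gen4 a b c d : <<[set a; b; c; d]>> = K ->
  <<[set coset M a; coset M b; coset M c; coset M d]>> = K / M.
Proof.
move=> genK; have sSN : [set a; b; c; d] \subset 'N(M).
  by apply: subset_trans nMK; rewrite -genK subset_gen.
by rewrite -[in RHS]genK quotient_gen // quotientE morphimEsub // !imsetU !imset_set1.
Qed.

End Quotient.

(** Modulo the Frattini subgroup, here equal to K', four generators leave at most 2^4 elements, and
    2^10 / 2^4 = 64. *)
Lemma card_der1_hatG3 (kT : finGroupType) (K : {group kT}) (a b c d : kT) :
  in_hatG3 K -> <<[set a; b; c; d]>> = K -> (64 <= #|K^`(1)|)%N.
Proof.
case=> [[pK _ [PhiZ K'Z] _] [cardK _]] genK.
have nPhi := normal_norm (Phi_normal K).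
have abQ : 2.-abelem (K / 'Phi(K)) by apply: Phi_quotient_abelem.
have nS : [set a; b; c; d] \subset 'N('Phi(K)).
  by apply: subset_trans nPhi; rewrite -[in X in _ \subset X]genK subset_gen.
have genQ : <<[set a; b; c; d] / 'Phi(K)>> = K / 'Phi(K) by rewrite -quotient_gen // genK.
have cardS : (#|[set a; b; c; d] / 'Phi(K)| <= 4)%N.
  apply: leq_trans (leq_morphim _ _) _.
  have -> : [set a; b; c; d] = [set x in [:: a; b; c; d]] by apply/setP=> x; rewrite !inE -!orbA.
  by rewrite cardsE (leq_trans (card_size _)).
have leQ : (#|K / 'Phi(K)| <= 16)%N.
  rewrite -genQ; apply: leq_trans (card_gen_exponent2 _ _) _.
  - by rewrite genQ (abelem_abelian abQ).
  - move=> x Sx; have Qx : x \in K / 'Phi(K) by rewrite -genQ mem_gen.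
    by case/abelemP: abQ => // _; apply.
  by rewrite (@leq_exp2l 2 _ 4).
rewrite K'Z -PhiZ leqNgt; apply/negP; rewrite ltnS => leP.
have := leq_mul leP leQ; rewrite card_quotient // Lagrange ?Phi_sub // cardK.
by [].
Qed.

Local Open Scope ring_scope.

(** [X] is additive only modulo the center, so sums are followed inside the join with Z(G). *)
Lemma coordinates_generate (gT : finGroupType) (G : {group gT}) m k X Y N
    (a b c d : 'rV['F_2]_m) :
  @commutator_coordinates gT G m k X Y N ->
  row_full (col_mx (col_mx a b) (col_mx c d)) ->
  G \subset (<<[set X a; X b; X c; X d]>> * 'Z(G))%g.
Proof.
case=> _ GX Xall XD _ _ _ _ full; set S := [set _; _; _; _]%g.
have nSZ : <<S>>%g \subset 'N('Z(G))%g.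
  rewrite gen_subG; apply: subset_trans (normal_norm (center_normal G)).
  by apply/subsetP=> x; rewrite !inE -!orbA => /or4P[]/eqP->.
rewrite -norm_joinEl //; pose A : {group gT} := (<<S>> <*> 'Z(G))%G; change (G \subset A).
have sZA : 'Z(G)%g \subset A by apply: joing_subr.
have AD u v : X u \in A -> X v \in A -> X (u + v) \in A.
  by move=> Au Av; have /lcosetP[z Zz ->] := XD u v; rewrite !groupM // (subsetP sZA).
have A0 : X 0 \in A.
  have := XD 0 0; rewrite addr0 => /lcosetP[z Zz].
  rewrite -mulgA -[LHS]mulg1 => /mulgI/esym/eqP; rewrite -eq_invg_mul => /eqP eqz.
  by rewrite -groupV eqz (subsetP sZA).
have AM (x : 'M['F_2]_1) u : X u \in A -> X (x *m u) \in A.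
  rewrite [x]mx11_scalar mul_scalar_mx => Au.
  by case: (F2_cases (x 0 0)) => ->; rewrite ?scale0r ?scale1r.
have memS x : x \in S -> x \in A by move=> Sx; apply: (subsetP (joing_subl _ _)); apply: mem_gen.
have [Aa Ab Ac Ad] : [/\ X a \in A, X b \in A, X c \in A & X d \in A].
  by split; apply: memS; rewrite !inE eqxx ?orbT.
apply/subsetP=> g /Xall[u /lcosetP[z Zz ->]]; apply: groupM; last exact: (subsetP sZA).
have /submxP[D ->] := submx_full u full.
rewrite -[D]hsubmxK mul_row_col -[lsubmx D]hsubmxK -[rsubmx D]hsubmxK !mul_row_col.
by apply: (AD); apply: AD; apply: AM.
Qed.

Lemma coordinates_dim (gT : finGroupType) (G : {group gT}) m k X Y N :
  @commutator_coordinates gT G m k X Y N -> G^`(1)%g != 1%g ->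
  (3 <= k)%N /\ #|G^`(1)%g| = (2 ^ k)%N.
Proof.
case=> rank3N _ _ _ Yinj _ YG' _ ntG'.
have cardG' : #|G^`(1)%g| = (2 ^ k)%N by rewrite -YG' card_imset // cardsT card_F2_rV.
split=> //; have lt0k : (0 < k)%N.
  rewrite lt0n; apply: contra ntG' => /eqP k0.
  by rewrite trivg_card1 cardG' k0.
have le4m := rank3_dim_ge4 rank3N lt0k.
have lt0m : (0 < m)%N by apply: leq_trans le4m.
have [_ rankN _] := rank3N; rewrite -(rankN (delta_mx 0 (Ordinal lt0m))) ?rank_leq_col //.
apply/eqP=> /matrixP/(_ 0 (Ordinal lt0m))/eqP.
by rewrite !mxE !eqxx oner_eq0.
Qed.

Local Close Scope ring_scope.

Lemma row_full4_basis : exists a b c d : 'rV['F_2]_4,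
  row_full (col_mx (col_mx a b) (col_mx c d)).
Proof.
pose A : 'M['F_2]_(1 + 1 + (1 + 1), 4) := (1%:M)%R.
exists (usubmx (usubmx A)), (dsubmx (usubmx A)), (usubmx (dsubmx A)), (dsubmx (dsubmx A)).
by rewrite !vsubmxK /row_full mxrank1.
Qed.

Section Classification.

Variables (gT hT : finGroupType) (G : {group gT}) (H : {group hT}) (k : nat).
Variables (X : 'rV['F_2]_4 -> gT) (Y : 'rV['F_2]_k -> gT).
Variables (N : {linear 'rV['F_2]_4 -> 'M['F_2]_(4, k)}).
Hypothesis coordG : commutator_coordinates G X Y N.
Hypotheses (G2 : {in G^`(1), forall x, x ^+ 2 = 1}) (cG : G^`(1) \subset 'Z(G)).
Hypotheses (H2 : {in H^`(1), forall x, x ^+ 2 = 1}) (cH : H^`(1) \subset 'Z(H)).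
Variables (a b c d : hT).
Hypothesis genH : <<[set a; b; c; d]>> = H.

Let GX u : X u \in G. Proof. by case: coordG. Qed.

Let HS : H \subset <<[set a; b; c; d]>> * 'Z(H).
Proof. by rewrite genH mulG_subl. Qed.

Let cardG' : #|G^`(1)| = (2 ^ k)%N.
Proof. by case: coordG => _ _ _ _ Yinj _ <- _; rewrite card_imset // cardsT card_F2_rV. Qed.

Let memH : [/\ a \in H, b \in H, c \in H & d \in H].
Proof. by rewrite -genH; split; apply: mem_gen; rewrite !inE eqxx ?orbT. Qed.

Let pairs_sub (u v w x : 'rV['F_2]_4) :
  [set (X u, a); (X v, b); (X w, c); (X x, d)] \subset setX G H.
Proof.
have [Ha Hb Hc Hd] := memH.
by apply/subsetP=> z; rewrite !inE -!orbA => /or4P[]/eqP->; rewrite !GX ?Ha ?Hb ?Hc ?Hd.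
Qed.

(** Six commutators face at least 2^6 elements on each side, so any basis can be paired with the
    generators of [H]. *)
Lemma isoclinic_dim6 : (6 <= k)%N -> (64 <= #|H^`(1)|)%N -> isoclinic G H.
Proof.
move=> le6 le64; have [u [v [w [x full]]]] := row_full4_basis.
apply: (@isoclinic_of_quadruples _ _ _ _ (X u, a) (X v, b) (X w, c) (X x, d)
  (commutators4 (X u, a) (X v, b) (X w, c) (X x, d))) => //.
- exact: coordinates_generate coordG full.
- by move=> z sz; rewrite mem_gen // inE.
by rewrite cardG' leq_exp2l.
Qed.

Lemma isoclinic_dim5 : k = 5%N -> (32 <= #|H^`(1)|)%N -> [~ a, b] = [~ c, d] -> isoclinic G H.
Proof.
move=> k5 le32 abcd; have rank3N := coord_rank3 coordG.
have [|u [v [w [x [full uvwx]]]]] := rank3_basis5 rank3N; first by rewrite k5.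
have eqG : [~ X u, X v] = [~ X w, X x].
  have [_ _ _ _ _ _ _ XY] := coordG.
  by rewrite !XY (rank3_skew rank3N v u) (rank3_skew rank3N x w) uvwx.
set A := (X u, a); set B := (X v, b); set C := (X w, c); set D := (X x, d).
have eqAB : [~ A, B] = [~ C, D].
  by rewrite -[LHS]/([~ X u, X v], [~ a, b]) eqG abcd.
apply: (@isoclinic_of_quadruples _ _ _ _ A B C D
  [:: [~ A, C]; [~ A, D]; [~ B, C]; [~ B, D]; [~ C, D]]) => //.
- exact: pairs_sub.
- exact: coordinates_generate coordG full.
- by move=> z; rewrite !inE => /orP[|/or4P[]] /eqP->; rewrite eqxx ?orbT.
- move=> z; rewrite /commutators4 eqAB !inE => z_in.
  by rewrite mem_gen // !inE; case/or4P: z_in => [->|->|->|/or3P[]->]; rewrite ?orbT.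
by rewrite cardG' k5.
Qed.

Lemma isoclinic_dim4 : k = 4%N -> (16 <= #|H^`(1)|)%N -> [~ a, b] = [~ c, d] ->
  [~ a, c] * [~ b, d] * [~ c, d] = 1 -> isoclinic G H.
Proof.
move=> k4 le16 abcd acbdcd; have rank3N := coord_rank3 coordG.
have [u [v [w [x [full uvwx uwvxwx]]]]] := rank3_basis4 rank3N k4.
have [_ _ _ _ Yinj YD _ XY] := coordG.
have eqG : [~ X u, X v] = [~ X w, X x].
  by rewrite !XY (rank3_skew rank3N v u) (rank3_skew rank3N x w) uvwx.
have eqG1 : [~ X u, X w] * [~ X v, X x] * [~ X w, X x] = 1.
  rewrite !XY (rank3_skew rank3N w u) (rank3_skew rank3N x v) (rank3_skew rank3N x w).
  rewrite -!YD uwvxwx; apply: (mulgI (Y 0%R)).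
  by rewrite -YD addr0 mulg1.
set A := (X u, a); set B := (X v, b); set C := (X w, c); set D := (X x, d).
have eqAB : [~ A, B] = [~ C, D].
  by rewrite -[LHS]/([~ X u, X v], [~ a, b]) eqG abcd.
(* The second relation eliminates [[~ B, D]] as well, leaving four commutators against 2^4
   elements. *)
have eqBD : [~ B, D] = [~ A, C]^-1 * [~ C, D]^-1.
  apply: (mulgI [~ A, C]); apply: (mulIg [~ C, D]); rewrite mulKVg mulVg.
  rewrite -[LHS]/([~ X u, X w] * [~ X v, X x] * [~ X w, X x], [~ a, c] * [~ b, d] * [~ c, d]).
  by rewrite eqG1 acbdcd.
apply: (@isoclinic_of_quadruples _ _ _ _ A B C D
  [:: [~ A, C]; [~ A, D]; [~ B, C]; [~ C, D]]) => //.
- exact: pairs_sub.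
- exact: coordinates_generate coordG full.
- by move=> z; rewrite !inE => /or4P[] /eqP->; rewrite eqxx ?orbT.
- have mem_s z : z \in [:: [~ A, C]; [~ A, D]; [~ B, C]; [~ C, D]] ->
      z \in <<[set z in [:: [~ A, C]; [~ A, D]; [~ B, C]; [~ C, D]]]>>.
    by move=> sz; rewrite mem_gen // inE.
  move=> z; rewrite /commutators4 eqAB eqBD inE => /orP[/eqP-> | ].
    by apply: mem_s; rewrite !inE eqxx ?orbT.
  rewrite inE => /orP[/eqP-> |]; first by apply: mem_s; rewrite !inE eqxx ?orbT.
  rewrite inE => /orP[/eqP-> |]; first by apply: mem_s; rewrite !inE eqxx ?orbT.
  rewrite inE => /orP[/eqP-> |]; first by apply: mem_s; rewrite !inE eqxx ?orbT.
  rewrite inE => /orP[/eqP-> |]; last first.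
    by rewrite inE => /eqP->; apply: mem_s; rewrite !inE eqxx ?orbT.
  by rewrite groupM ?groupV //; apply: mem_s; rewrite !inE eqxx ?orbT.
by rewrite cardG' k4.
Qed.

End Classification.

Theorem theorem1p3 (gT kT : finGroupType) (G : {group gT}) (K : {group kT})
    (a b c d : kT) :
  2.-group G -> conjugate_type G [:: 1; 8]%N -> nil_class G = 2 ->
  in_hatG3 K -> min_generates [set a; b; c; d] K ->
  let M := <<[set [~ a, b] * [~ c, d]]%g>>%G in
  let N := <<[set [~ a, b] * [~ c, d];
                  [~ a, c] * [~ b, d] * [~ c, d]]%g>>%G in
  [/\ M <| K, N <| K
    & [\/ exists (cT : finGroupType) (C : {group cT}),
            [/\ 2.-group C, Camina C, #|C^`(1)| = 8 & isoclinic G C],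
          isoclinic G K,
          isoclinic G (K / M)%G
        | isoclinic G (K / N)%G ] ].
Proof.
move=> pG typeG clG hatK /minsetp/eqP genK M N.
have [[pK _ [_ K'Z] abZ] _] := hatK.
have le64 := card_der1_hatG3 hatK genK.
have cK : K^`(1) \subset 'Z(K) by rewrite K'Z.
have K2 : {in K^`(1), forall x, x ^+ 2 = 1} by rewrite K'Z; case/abelemP: abZ.
have [Ka Kb Kc Kd] : [/\ a \in K, b \in K, c \in K & d \in K].
  by rewrite -genK; split; apply: mem_gen; rewrite !inE eqxx ?orbT.
have u1K' : [~ a, b] * [~ c, d] \in K^`(1) by apply: groupM; apply: mem_commg.
have u2K' : [~ a, c] * [~ b, d] * [~ c, d] \in K^`(1).
  by apply: groupM; [apply: groupM |]; apply: mem_commg.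
have sMK' : M \subset K^`(1) by rewrite gen_subG sub1set.
have sNK' : N \subset K^`(1) by rewrite gen_subG subUset !sub1set u1K'.
have abK' : abelian K^`(1) by rewrite K'Z center_abelian.
(* The bounds 2 and 4 leave at least 32 and 16 of the 64 elements in the derived subgroups of K/M
   and K/N, as five and four commutators require. *)
have leM : (#|M| <= 2)%N.
  apply: leq_trans (card_gen_exponent2 (abelianS sMK' abK') _) _; last by rewrite cards1.
  by move=> x /set1P->; apply: K2.
have leN : (#|N| <= 4)%N.
  apply: leq_trans (card_gen_exponent2 (abelianS sNK' abK') _) _.
    by move=> x /set2P[] ->; apply: K2.
  by rewrite (@leq_exp2l 2 _ 2) // cards2; case: (_ != _).
have nMK := normal_sub_der1 cK sMK'; have nNK := normal_sub_der1 cK sNK'.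
split=> //.
have G2 := der1_sqr pG typeG clG; have cG := class2_der1_sub clG.
have [m [k [X [Y [F coordG]]]]] := class2_coordinates pG typeG clG.
have [le3 _] := coordinates_dim coordG (der1_neq1 clG).
have [k3 | lt3] := eqVneq k 3%N.
  have [altF _ _] := coord_rank3 coordG.
  have [beta biadd betaE] := F2_alternating_polarize altF.
  constructor 1; exists (central_ext biadd), [set: central_ext biadd]%G; split.
  - exact: pgroup_central_ext.
  - exact: (Camina_central_ext coordG betaE k3).
  - exact: (card_der1_central_ext coordG biadd betaE k3).
  - exact: (isoclinic_central_ext coordG biadd betaE).
have le4 : (4 <= k)%N by rewrite ltn_neqAle eq_sym lt3.
have m4 := rank3_dim4 (coord_rank3 coordG) le4; subst m.
have [k4 | [k5 | le6]] : k = 4%N \/ k = 5%N \/ (6 <= k)%N by move: le4; clear; lia.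
- constructor 4; apply: (isoclinic_dim4 coordG G2 cG _ _ (quotient_gen4 cK sNK' genK) k4).
  + exact: quotient_der1_sqr.
  + exact: quotient_der1_central.
  + by rewrite -(@leq_pmul2l 4) // (leq_trans le64) // card_quotient_der1.
  + by apply: (quotient_comm_eq K2 cK sNK' Ka Kb Kc Kd); apply: mem_gen; rewrite !inE eqxx.
  + by apply: (quotient_comm_prod3 cK sNK' Ka Kb Kc Kd); apply: mem_gen; rewrite !inE eqxx orbT.
- constructor 3; apply: (isoclinic_dim5 coordG G2 cG _ _ (quotient_gen4 cK sMK' genK) k5).
  + exact: quotient_der1_sqr.
  + exact: quotient_der1_central.
  + by rewrite -(@leq_pmul2l 2) // (leq_trans le64) // card_quotient_der1.
  by apply: (quotient_comm_eq K2 cK sMK' Ka Kb Kc Kd); apply: mem_gen; rewrite !inE eqxx.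
by constructor 2; apply: (isoclinic_dim6 coordG G2 cG K2 cK genK le6 le64).
Qed.
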